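(* Let $n\ge 2$, let $h$ be the dilation of $\mathbb{R}^n$ with signature of positive integers $r_1\le r_2\le\dots\le r_n$, and put $\ell=r_n-2r_{n-1}$. (a) If $\ell\ge 0$, then $\ell$ is the first wrong weight for $h$, and the space of derivations of weight $\ell$ consists of vector fields of weight $\ell$ extended by derivations of the second kind: $\mathfrak{g}_\ell^T=\{\mathrm{ad}_X|_{\mathfrak m}+D : X\in\mathfrak{g}_\ell(h),\ D \text{ a derivation of the second kind}\}$. (b) The Tanaka prolongation consists of vector fields, i.e. $$\mathfrak{g}_T^{(k)}(\mathfrak{m})=\mathfrak{m}\oplus\mathfrak{g}_0(h)\oplus\mathfrak{g}_1(h)\oplus\dots\oplus\mathfrak{g}_k(h)\quad\text{for all }k=0,1,2,\dots,$$ if and only if $\ell<0$.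
   Context: The dilation $h$ of $\mathbb{R}^n$ (coordinates $x^1,\dots,x^n$) with signature of positive integers $r_1\le\dots\le r_n$ is $h_t(x^1,\dots,x^n)=(t^{r_1}x^1,\dots,t^{r_n}x^n)$, with weight vector field $\nabla^h=\sum_i r_i x^i\partial_{x^i}$. For $k\in\mathbb{Z}$, $\mathfrak{g}_k(h)$ is the real vector space of smooth vector fields $X$ on $\mathbb{R}^n$ with $[\nabla^h,X]=kX$ (vector fields of weight $k$); these are automatically polynomial, $\mathfrak{g}_k(h)=0$ for $k<-r_n$, and $[\mathfrak{g}_k(h),\mathfrak{g}_l(h)]\subset\mathfrak{g}_{k+l}(h)$. $\mathfrak{m}=\mathfrak{g}_{<0}(h)=\bigoplus_{p=-r_n}^{-1}\mathfrak{g}_p(h)$ is a finite-dimensional nilpotent graded Lie algebra. Tanaka prolongation. Put $\mathfrak{g}_p^T=\mathfrak{g}_p(h)$ for $p<0$, and for $k\ge 0$ define inductively $$\mathfrak{g}_k^T=\Big\{v\in\bigoplus_{p<0}\mathfrak{g}_{p+k}^T\otimes\mathfrak{g}_p(h)^*\ \Big|\ v([X,Y])=[v(X),Y]+[X,v(Y)]\ \text{for all }X,Y\in\mathfrak{m}\Big\},$$ where such $v$ is regarded as a linear map on $\mathfrak{m}$ sending $\mathfrak{g}_p(h)$ to $\mathfrak{g}_{p+k}^T$, and where for $u\in\mathfrak{g}_i^T$ with $i\ge0$ and $Y\in\mathfrak{m}$ one sets $[u,Y]=u(Y)=-[Y,u]$ (for $u\in\mathfrak{m}$ the bracket is that of $\mathfrak{m}$).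 Elements of $\mathfrak{g}_k^T$ are called (graded) derivations of $\mathfrak{m}$ of weight $k$. The $l$th Tanaka prolongation is $\mathfrak{g}_T^{(l)}(\mathfrak{m})=\mathfrak{m}\oplus\mathfrak{g}_0^T\oplus\mathfrak{g}_1^T\oplus\dots\oplus\mathfrak{g}_l^T$. Each $X\in\mathfrak{g}_k(h)$, $k\ge0$, defines a derivation $\mathrm{ad}_X|_{\mathfrak m}:Y\mapsto[X,Y]$ of weight $k$; via $X\mapsto\mathrm{ad}_X|_{\mathfrak m}$ (inductively in $k$) $\mathfrak{g}_k(h)$ is identified with a subspace of $\mathfrak{g}_k^T$, and equalities such as $\mathfrak{g}_k^T=\mathfrak{g}_k(h)$ are understood in this sense (every derivation of weight $k$ comes from a vector field of weight $k$). First wrong weight. An integer $\ell\ge0$ is the first wrong weight of $h$ if $\mathfrak{g}_k^T=\mathfrak{g}_k(h)$ for all $0\le k<\ell$, while $\mathfrak{g}_\ell^T$ is strictly larger than $\mathfrak{g}_\ell(h)$. Derivations of the second kind. Suppose $\ell=r_n-2r_{n-1}\ge 0$. A derivation of the second kind is a linear map $D$ from $\mathfrak{m}$ to polynomial vector fields, with $D(\mathfrak{g}_p(h))\subset\mathfrak{g}_{p+\ell}(h)$ for $p<0$ and $D([X,Y])=[D(X),Y]+[X,D(Y)]$ for all $X,Y\in\mathfrak{m}$, such that $D(\partial_{x^i})=0$ for all $i$ and, for some symmetric real matrix $A=(a_i^j)_{i,j=1}^{n-1}$ with $a_i^j\ne0$ only if $r_i=r_j=r_{n-1}$, one has $D(x^i\partial_{x^j})=\delta_j^n\sum_{k=1}^{n-1}a_i^k\,\partial_{x^k}$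 for all linear $x^i\partial_{x^j}\in\mathfrak{m}$ (i.e. $r_i<r_j$). *)

(* Defs.v *)
From HB Require Import structures.
From mathcomp Require Import all_boot all_order all_algebra.
From mathcomp Require Import all_classical all_reals all_analysis.

Set Implicit Arguments.
Unset Strict Implicit.
Unset Printing Implicit Defensive.

Import Order.TTheory GRing.Theory Num.Theory.
Import numFieldNormedType.Exports.

Local Open Scope classical_set_scope.
Local Open Scope ring_scope.

Notation vfield R n := ('rV[R]_n -> 'rV[R]_n).

(* C^oo: every iterated partial derivative is (Frechet) differentiable, hence
   continuous, at every point. *)
Definition smooth (R : realType) (n : nat) (X : vfield R n) : Prop :=
  forall (s : seq 'I_n) (x : 'rV[R]_n),
    differentiable
      (foldr (fun i (f : vfield R n) => 'D_(delta_mx 0 i) f) X s) x.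

Definition lie (R : realType) (n : nat) (X Y : vfield R n) : vfield R n :=
  fun x => 'D_(X x) Y x - 'D_(Y x) X x.

Definition dd (R : realType) (n : nat) (i : 'I_n) : vfield R n :=
  fun _ => delta_mx 0 i.
Arguments dd R {n} i.

Definition xdd (R : realType) (n : nat) (i j : 'I_n) : vfield R n :=
  fun x => x 0 i *: delta_mx 0 j.
Arguments xdd R {n} i j.

Definition nablah (R : realType) (n : nat) (r : 'I_n -> nat) : vfield R n :=
  \sum_(i < n) (r i)%:R *: xdd R i i.
Arguments nablah R {n} r.

Definition gh (R : realType) (n : nat) (r : 'I_n -> nat) (k : int) :
    set (vfield R n) :=
  [set X | smooth X /\ lie (nablah R r) X = k%:~R *: X].

(* The sum of the g_p(h), -r_n <= p <= -1; the family Z lists the homogeneous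
   components, Z q having weight -(q+1).  Dimension n.+1 so that r_n exists. *)
Definition mneg (R : realType) (n : nat) (r : 'I_n.+1 -> nat) :
    set (vfield R n.+1) :=
  [set X | exists Z : 'I_(r ord_max) -> vfield R n.+1,
     (forall q : 'I_(r ord_max), gh r (- (q.+1)%:Z) (Z q)) /\
     X = \sum_(q < r ord_max) Z q].

Definition linear_on_m (R : realType) (n : nat) (r : 'I_n.+1 -> nat)
    (A : lmodType R) (v : vfield R n.+1 -> A) : Prop :=
  forall (a : R) (X Y : vfield R n.+1), mneg r X -> mneg r Y ->
    v (a *: X + Y) = a *: v X + v Y.

(* Linear maps m -> A, encoded as functions on all vector fields that are zero
   outside m, so that equal maps are represented by equal functions. *)
Definition mhom (R : realType) (n : nat) (r : 'I_n.+1 -> nat)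
    (A : lmodType R) : set (vfield R n.+1 -> A) :=
  [set v | linear_on_m r v /\ (forall X, ~ mneg r X -> v X = 0)].

(* Ambient space of m (+) g_0^T (+) ... (+) g_{l-1}^T: a vector field together
   with, for each k < l, a map from vector fields to [tower k]. *)
Fixpoint tower (R : realType) (n l : nat) : lmodType R :=
  match l with
  | 0 => GRing.Lmodule.clone R (vfield R n) _
  | l'.+1 => GRing.Lmodule.clone R
               (tower R n l' * (vfield R n -> tower R n l'))%type _
  end.

(* [u, Y] for Y in m: the bracket of vector fields on the m component of u and
   evaluation at Y on the components in g_k^T, k >= 0. *)
Fixpoint tbr (R : realType) (n l : nat) :
    tower R n l -> vfield R n -> tower R n l :=
  match l return tower R n l -> vfield R n -> tower R n l with
  | 0 => fun u Y => lie u Y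
  | l'.+1 => fun u Y => (tbr u.1 Y + u.2 Y, 0)
  end.
Arguments tbr R {n} l u Y.

(* The maps v of weight k satisfying v[X,Y] = [vX,Y] + [X,vY], given the
   homogeneous parts S of the target and its brackets br on the right by
   elements of m; the term [X,vY] is -[vY,X]. *)
Definition derivations (R : realType) (n : nat) (r : 'I_n.+1 -> nat)
    (A : lmodType R) (S : int -> set A) (br : A -> vfield R n.+1 -> A)
    (k : int) : set (vfield R n.+1 -> A) :=
  [set v | [/\ mhom r v,
      forall (p : int) (X : vfield R n.+1), p < 0 -> gh r p X ->
        S (p + k) (v X)
    & forall X Y : vfield R n.+1, mneg r X -> mneg r Y ->
        v (lie X Y) = br (v X) Y - br (v Y) X]].

(* g_i^T inside [tower l], for i < l. *)
Fixpoint tpart (R : realType) (n : nat) (r : 'I_n.+1 -> nat) (l : nat) :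
    int -> set (tower R n.+1 l) :=
  match l return int -> set (tower R n.+1 l) with
  | 0 => fun i => [set X | i < 0 /\ gh r i X]
  | l'.+1 => fun i =>
      if i == l'%:Z then
        [set u | u.1 = 0 /\
           derivations r (@tpart R n r l') (@tbr R n.+1 l') l'%:Z u.2]
      else [set u | @tpart R n r l' i u.1 /\ u.2 = 0]
  end.
Arguments tpart R {n} r l i _.

Definition gT (R : realType) (n : nat) (r : 'I_n.+1 -> nat) (k : nat) :
    set (vfield R n.+1 -> tower R n.+1 k) :=
  derivations r (tpart R r k) (tbr R k) k%:Z.
Arguments gT R {n} r k.

(* Linear maps v on m whose values correspond, under [emb] (where [emb i X a]
   means that a is the image of the vector field X of weight i), to those of
   the vector-field-valued map w of weight k. *)
Definition realizes (R : realType) (n : nat) (r : 'I_n.+1 -> nat)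
    (A : lmodType R) (emb : int -> vfield R n.+1 -> set A) (k : int)
    (w : vfield R n.+1 -> vfield R n.+1) : set (vfield R n.+1 -> A) :=
  [set v | mhom r v /\
     forall (p : int) (Y : vfield R n.+1), p < 0 -> gh r p Y ->
       emb (p + k) (w Y) (v Y)].

(* The identification X |-> ad_X|m of g_i(h) with a subspace of g_i^T, for
   i < l (the identity when i < 0), as a relation. *)
Fixpoint temb (R : realType) (n : nat) (r : 'I_n.+1 -> nat) (l : nat) :
    int -> vfield R n.+1 -> set (tower R n.+1 l) :=
  match l return int -> vfield R n.+1 -> set (tower R n.+1 l) with
  | 0 => fun _ X => [set X]
  | l'.+1 => fun i X =>
      if i == l'%:Z then
        [set u | u.1 = 0 /\ realizes r (@temb R n r l') l'%:Z (lie X) u.2]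
      else [set u | @temb R n r l' i X u.1 /\ u.2 = 0]
  end.
Arguments temb R {n} r l i X _.

(* Elements of Hom(m, [tower k]) that are the linear map w of weight k, whose
   values are vector fields. *)
Definition from_vf (R : realType) (n : nat) (r : 'I_n.+1 -> nat) (k : nat)
    (w : vfield R n.+1 -> vfield R n.+1) :
    set (vfield R n.+1 -> tower R n.+1 k) :=
  realizes r (temb R r k) k%:Z w.

(* g_k(h) as a subset of g_k^T. *)
Definition ghT (R : realType) (n : nat) (r : 'I_n.+1 -> nat) (k : nat) :
    set (vfield R n.+1 -> tower R n.+1 k) :=
  [set v | exists2 X : vfield R n.+1, gh r k%:Z X & from_vf r (lie X) v].
Arguments ghT R {n} r k.

(* m (+) S_0 (+) ... (+) S_{l-1}. *)
Fixpoint msum (R : realType) (n : nat) (r : 'I_n.+1 -> nat)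
    (S : forall k : nat, set (vfield R n.+1 -> tower R n.+1 k)) (l : nat) :
    set (tower R n.+1 l) :=
  match l return set (tower R n.+1 l) with
  | 0 => mneg r
  | l'.+1 => [set u | @msum R n r S l' u.1 /\ S l' u.2]
  end.
Arguments msum {R n} r S l _.

Definition tanaka (R : realType) (n : nat) (r : 'I_n.+1 -> nat) (k : nat) :
    set (tower R n.+1 k.+1) :=
  msum r (gT R r) k.+1.
Arguments tanaka R {n} r k.

Definition vf_prolongation (R : realType) (n : nat) (r : 'I_n.+1 -> nat)
    (k : nat) : set (tower R n.+1 k.+1) :=
  msum r (ghT R r) k.+1.
Arguments vf_prolongation R {n} r k.

Definition first_wrong_weight (R : realType) (n : nat) (r : 'I_n.+1 -> nat)
    (l : nat) : Prop :=
  (forall k : nat, (k < l)%N -> gT R r k = ghT R r k) /\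
  ghT R r l `<` gT R r l.
Arguments first_wrong_weight R {n} r l.

Definition signature (n : nat) (r : 'I_n -> nat) : Prop :=
  (forall i : 'I_n, (0 < r i)%N) /\
  (forall i j : 'I_n, (i <= j)%N -> (r i <= r j)%N).

(* The index i in {1..n-1} seen in {1..n}, where n is here n.+2. *)
Definition low (n : nat) (i : 'I_n.+1) : 'I_n.+2 := widen_ord (leqnSn n.+1) i.

Definition r_last (n : nat) (r : 'I_n.+2 -> nat) : nat := r ord_max.
Definition r_penult (n : nat) (r : 'I_n.+2 -> nat) : nat := r (low ord_max).

Definition ell (n : nat) (r : 'I_n.+2 -> nat) : int :=
  (r_last r)%:Z - 2 * (r_penult r)%:Z.

(* Only the values of D on m matter.  The factor delta_j^n is split into the
   cases j < n and j = n; in the latter r_i < r_n forces i <= n-1. *)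
Definition second_kind (R : realType) (n : nat) (r : 'I_n.+2 -> nat)
    (D : vfield R n.+2 -> vfield R n.+2) : Prop :=
  [/\ linear_on_m r D,
      forall (p : int) (X : vfield R n.+2), p < 0 -> gh r p X ->
        gh r (p + ell r) (D X),
      forall X Y : vfield R n.+2, mneg r X -> mneg r Y ->
        D (lie X Y) = lie (D X) Y + lie X (D Y),
      forall i : 'I_n.+2, D (dd R i) = 0
    & exists A : 'M[R]_n.+1,
      [/\ A^T = A,
          forall i j : 'I_n.+1, A i j != 0 ->
            r (low i) = r_penult r /\ r (low j) = r_penult r,
          forall i j : 'I_n.+2, (r i < r j)%N -> j != ord_max ->
            D (xdd R i j) = 0
        & forall i : 'I_n.+1, (r (low i) < r_last r)%N ->
            D (xdd R (low i) ord_max) =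
              \sum_(k < n.+1) A i k *: dd R (low k)]].

(* Main.v *)
(* Subtracting ad_X from a derivation D of weight k >= 0 of m, where X is given
   by Euler's formula applied to the closed family (D d_1, .., D d_n), one may
   assume that D kills the d_i.  Then D commutes with the d_i, so D (x_i d_j) is
   a constant field sum_a u_ij^a d_a with r_a + r_i + k = r_j.  Bracketing
   x_i d_j with x_a d_j, x_a d_b and x_a d_i gives u_ij^a = u_aj^i, kills u_ij^a
   as soon as r_a < r_b for some b other than i, j, and gives u_ij^a = - u_aj^i
   if j = n and r_a < r_i.  Hence u_ij^a <> 0 forces j = n, r_i = r_a = r_{n-1}
   and k = r_n - 2 r_{n-1}, with u symmetric: D is of the second kind.  If the
   u_ij^a all vanish then D = 0, since a field f d_j of m commutes with every
   x_c d_j of m.  So m, g_0, .., g_{k-1} are inductively identified with vector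
   fields as long as k <= l, and at k = l = r_n - 2 r_{n-1} >= 0 the derivation
   Y |-> (d_{n-1} Y^n) d_{n-1} is not of the form ad_X. *)
Require Import Defs.
From HB Require Import structures.
From mathcomp Require Import all_boot all_order all_algebra.
From mathcomp Require Import all_classical all_reals all_analysis.
From mathcomp Require Import ring zify.

Set Implicit Arguments.
Unset Strict Implicit.
Unset Printing Implicit Defensive.

Import Order.TTheory GRing.Theory Num.Theory.
Import numFieldNormedType.Exports.

Local Open Scope classical_set_scope.
Local Open Scope ring_scope.

(** * Polynomial vector fields *)

(** Weight spaces are defined by smooth fields and a bracket equation, so polynomiality has to be
    proved before any algebra. A component of weight [w] satisfies Euler's equation; integrating it
    along the dilations makes the component zero for [w < 0] and constant for [w = 0], while for
    [w > 0] it is recovered from its partial derivatives, which have smaller weight. The other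
    obstacle is that elements of [gT] are iterated maps, matched with vector fields only through a
    relation. A derivation of weight [l] takes values in weights below [l], so a match in those
    weights suffices to replace it by a derivation with values in vector fields. This is why the
    classification still applies at [l = ell], the very weight where the match breaks. In (b), the
    new element of weight [ell] separates the two prolongations of order [ell]. *)

Section PolynomialFields.
Variables (R : realType) (n : nat).
Implicit Types (X Y Z : vfield R n) (x u : 'rV[R]_n) (i j : 'I_n).

(* Locked, as are the products [act] below: conversion would otherwise unfold
   limits and matrix operations. *)
Fact pd_key : unit. Proof. by []. Qed.
Definition pd i X : vfield R n := locked_with pd_key ('D_(delta_mx 0 i) X).

Lemma pdE i X x : pd i X x = 'D_(delta_mx 0 i) X x.
Proof. by rewrite /pd unlock. Qed.

Lemma entryD X Y x j : (X + Y) x 0 j = X x 0 j + Y x 0 j.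
Proof. exact: mxE. Qed.

Lemma entryN X x j : (- X) x 0 j = - X x 0 j.
Proof. exact: mxE. Qed.

Lemma entryB X Y x j : (X - Y) x 0 j = X x 0 j - Y x 0 j.
Proof. by rewrite entryD entryN. Qed.

Lemma entryZ a X x j : (a *: X) x 0 j = a * X x 0 j.
Proof. exact: mxE. Qed.

Lemma derive_coord X x u j : differentiable X x ->
  'D_u X x 0 j = 'D_u (fun y => X y 0 j) x.
Proof.
by move=> dX; rewrite derive_mx ?mxE//; exact: diff_derivable.
Qed.

Lemma differentiable_rV X x :
  (forall j, differentiable (fun y : 'rV[R]_n => X y 0 j) x) -> differentiable X x.
Proof.
move=> dX.
have -> : X = \sum_(j < n) (fun y : 'rV[R]_n => X y 0 j *: delta_mx 0 j).
  by apply/funext => y; rewrite fct_sumE -row_sum_delta.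
by apply: differentiable_sum => j; exact: differentiableZl.
Qed.

Lemma differentiable_entry X x j :
  differentiable X x -> differentiable (fun y : 'rV[R]_n => X y 0 j) x.
Proof.
move=> dX; exact: (differentiable_comp dX (differentiable_coord _ _ _)).
Qed.

Lemma derive_sum_pd X x u : differentiable X x ->
  'D_u X x = \sum_(i < n) u 0 i *: pd i X x.
Proof.
move=> dX; rewrite deriveE// [in LHS](row_sum_delta u) linear_sum.
by apply: eq_bigr => i _; rewrite linearZ pdE deriveE.
Qed.

Lemma differentiable_entryZ X Y x i : differentiable X x -> differentiable Y x ->
  differentiable (fun y : 'rV[R]_n => X y 0 i *: Y y) x.
Proof.
move=> dX dY; apply: differentiable_rV => j.
have -> : (fun y : 'rV[R]_n => (X y 0 i *: Y y) 0 j) =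
    (fun y : 'rV[R]_n => X y 0 i) * (fun y : 'rV[R]_n => Y y 0 j).
  by apply/funext => y; rewrite mxE.
by apply: differentiableM; exact: differentiable_entry.
Qed.

Lemma pd_entryZ X Y x i j : differentiable X x -> differentiable Y x ->
  pd j (fun y => X y 0 i *: Y y) x =
  pd j X x 0 i *: Y x + X x 0 i *: pd j Y x.
Proof.
move=> dX dY; apply/rowP => k.
rewrite !pdE derive_coord; last exact: differentiable_entryZ.
have -> : (fun y : 'rV[R]_n => (X y 0 i *: Y y) 0 k) =
    (fun y : 'rV[R]_n => X y 0 i) * (fun y : 'rV[R]_n => Y y 0 k).
  by apply/funext => y; rewrite mxE.
have dXi := differentiable_entry i dX; have dYk := differentiable_entry k dY.
rewrite deriveM; [|exact: diff_derivable..].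
by rewrite !mxE -!derive_coord// [RHS]addrC [X in _ = _ + X]mulrC.
Qed.

Lemma pd_coordZ X x i j : differentiable X x ->
  pd j (fun y => y 0 i *: X y) x = (i == j)%:R *: X x + x 0 i *: pd j X x.
Proof.
by move=> dX; rewrite (@pd_entryZ id)// [pd j id x]pdE derive_id mxE eqxx.
Qed.

(* Polynomial maps described inductively, so that smoothness and the symmetry
   of second derivatives need no analysis. *)
Inductive polyvf : vfield R n -> Prop :=
| polyvf_cst u : polyvf (cst u)
| polyvf_coordZ i X : polyvf X -> polyvf (fun x => x 0 i *: X x)
| polyvfD X Y : polyvf X -> polyvf Y -> polyvf (X + Y).

Lemma polyvf_diff X x : polyvf X -> differentiable X x.
Proof.
elim=> [u|i Y _|Y Z _ dY _ dZ]; first exact: differentiable_cst.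
- exact: (@differentiable_entryZ id).
- exact: differentiableD.
Qed.
#[local] Hint Resolve polyvf_diff : core.

Lemma pd_cst i u : pd i (cst u) = 0.
Proof. by apply/funext => x; rewrite !pdE derive_cst. Qed.

Lemma pd0 i : pd i 0 = 0.
Proof. exact: (pd_cst i 0). Qed.

Lemma pdD i X Y : polyvf X -> polyvf Y -> pd i (X + Y) = pd i X + pd i Y.
Proof.
move=> pX pY; apply/funext => x.
by rewrite pdE deriveD -?pdE//; exact/diff_derivable/polyvf_diff.
Qed.

Lemma pdZ i a X : polyvf X -> pd i (a *: X) = a *: pd i X.
Proof.
move=> pX; apply/funext => x.
by rewrite pdE deriveZ -?pdE//; exact/diff_derivable/polyvf_diff.
Qed.

Lemma pd_polyvf_coordZ i j X : polyvf X ->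
  pd j (fun y => y 0 i *: X y) =
  (i == j)%:R *: X + (fun y => y 0 i *: pd j X y).
Proof.
by move=> pX; apply/funext => x; rewrite pd_coordZ//; exact: polyvf_diff.
Qed.

Lemma polyvfZ a X : polyvf X -> polyvf (a *: X).
Proof.
elim=> [u|i Y _ IH|Y Z _ IY _ IZ].
- exact: (polyvf_cst (a *: u)).
- rewrite [X in polyvf X](_ : _ = fun x => x 0 i *: (a *: Y) x); first exact: polyvf_coordZ.
  by apply/funext => x /=; rewrite !fctE !scalerA mulrC.
- by rewrite scalerDr; exact: polyvfD.
Qed.

Lemma polyvf0 : polyvf 0.
Proof. exact: (polyvf_cst 0). Qed.

Lemma polyvfN X : polyvf X -> polyvf (- X).
Proof. by move=> pX; rewrite -scaleN1r; exact: polyvfZ. Qed.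

Lemma polyvfB X Y : polyvf X -> polyvf Y -> polyvf (X - Y).
Proof. by move=> pX pY; apply: polyvfD => //; exact: polyvfN. Qed.

Lemma pdB i X Y : polyvf X -> polyvf Y -> pd i (X - Y) = pd i X - pd i Y.
Proof.
by move=> pX pY; rewrite (pdD i pX (polyvfN pY)) -scaleN1r (pdZ i _ pY) scaleN1r.
Qed.

Lemma polyvf_sum (I : Type) (s : seq I) (P : pred I) (F : I -> vfield R n) :
  (forall k, P k -> polyvf (F k)) -> polyvf (\sum_(k <- s | P k) F k).
Proof.
move=> pF; elim/big_ind: _ => //; [exact: polyvf0|exact: polyvfD].
Qed.

Lemma polyvf_pd i X : polyvf X -> polyvf (pd i X).
Proof.
elim=> [u|j Y pY IH|Y Z pY IY pZ IZ].
- by rewrite pd_cst; exact: polyvf0.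
- by rewrite pd_polyvf_coordZ//; apply: polyvfD; [exact: polyvfZ|exact: polyvf_coordZ].
- by rewrite pdD//; exact: polyvfD.
Qed.

Lemma polyvf_smooth X : polyvf X -> smooth X.
Proof.
move=> pX s x; apply: polyvf_diff.
by elim: s => //= i s /(polyvf_pd i); rewrite /pd unlock.
Qed.

(** Induction on the construction of [X]: for a product by a coordinate, exchanging [a] and [b] in
    [E] only permutes the first two summands, and the third is the induction hypothesis. *)
Lemma pdC i j X : polyvf X -> pd i (pd j X) = pd j (pd i X).
Proof.
elim=> [u|k Y pY IH|Y Z pY IY pZ IZ].
- by rewrite !pd_cst.
- have pjY := polyvf_pd j pY; have piY := polyvf_pd i pY.
  have E a b : polyvf (pd a Y) -> polyvf (pd b Y) ->
      pd a (pd b (fun y => y 0 k *: Y y)) =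
      (k == b)%:R *: pd a Y + ((k == a)%:R *: pd b Y +
        (fun y => y 0 k *: pd a (pd b Y) y)).
    move=> pa pb; rewrite (pd_polyvf_coordZ k b pY).
    rewrite (pdD a (polyvfZ _ pY) (polyvf_coordZ k pb)).
    by rewrite (pdZ a _ pY) (pd_polyvf_coordZ k a pb).
  rewrite (E i j piY pjY) (E j i pjY piY) IH; exact: addrCA.
- rewrite (pdD j pY pZ) (pdD i pY pZ).
  rewrite (pdD i (polyvf_pd j pY) (polyvf_pd j pZ)).
  by rewrite (pdD j (polyvf_pd i pY) (polyvf_pd i pZ)) IY IZ.
Qed.

Lemma polyvf_mul X Y i : polyvf X -> polyvf Y -> polyvf (fun x => X x 0 i *: Y x).
Proof.
move=> + pY; elim=> [u|j Z _ IH|Z Z' _ IZ _ IZ'].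
- exact: polyvfZ.
- rewrite [X in polyvf X](_ : _ = fun x => x 0 j *: (Z x 0 i *: Y x)).
    exact: (polyvf_coordZ j IH).
  by apply/funext => x; rewrite mxE scalerA.
- rewrite [X in polyvf X](_ : _ = (fun x => Z x 0 i *: Y x) +
     (fun x => Z' x 0 i *: Y x)); first exact: polyvfD.
  by apply/funext => x; rewrite !fctE mxE scalerDl.
Qed.

Lemma polyvf_mulmx X (M : 'M[R]_n) : polyvf X -> polyvf (fun x => X x *m M).
Proof.
elim=> [u|i Y _ IH|Y Z _ IY _ IZ].
- exact: (polyvf_cst (u *m M)).
- rewrite [X in polyvf X](_ : _ = fun x => x 0 i *: (Y x *m M)).
    exact: (polyvf_coordZ i IH).
  by apply/funext => x; rewrite scalemxAl.
- rewrite [X in polyvf X](_ : _ = (fun x => Y x *m M) + (fun x => Z x *m M)).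
    exact: polyvfD.
  by apply/funext => x; rewrite !fctE mulmxDl.
Qed.

Lemma pd_mulmx i X (M : 'M[R]_n) : polyvf X ->
  pd i (fun x => X x *m M) = (fun x => pd i X x *m M).
Proof.
elim=> [u|j Y pY IH|Y Z pY IY pZ IZ].
- rewrite (pd_cst i u); apply/funext => x.
  by rewrite mul0mx -[LHS]/(pd i (cst (u *m M)) x) pd_cst.
- have -> : (fun x => (x 0 j *: Y x) *m M) = (fun x => x 0 j *: (Y x *m M)).
    by apply/funext => x; rewrite scalemxAl.
  rewrite (pd_polyvf_coordZ j i (polyvf_mulmx M pY)) (pd_polyvf_coordZ j i pY) IH.
  by apply/funext => x; rewrite mulmxDl -!scalemxAl.
- have -> : (fun x => (Y + Z) x *m M) = (fun x => Y x *m M) + (fun x => Z x *m M).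
    by apply/funext => x; rewrite !fctE mulmxDl.
  rewrite (pdD i (polyvf_mulmx M pY) (polyvf_mulmx M pZ)) (pdD i pY pZ) IY IZ.
  by apply/funext => x; rewrite mulmxDl.
Qed.

End PolynomialFields.

(** * Smooth weighted-homogeneous maps are polynomial *)

Section EulerHomogeneous.
Variables (R : realType) (n : nat) (r : 'I_n -> nat).
Implicit Types (X : vfield R n) (x y : 'rV[R]_n) (t : R) (i : 'I_n) (w : int).

Lemma nablahE x : nablah R r x = \row_i ((r i)%:R * x 0 i).
Proof.
rewrite /nablah fct_sumE [RHS]row_sum_delta; apply: eq_bigr => i _.
by rewrite mxE -scalerA.
Qed.

(** The dilation $h_t$, kept total at [t = 0], where it contracts everything to the origin; this
    endpoint is what compares [f x] with [f 0]. *)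
Definition dil t x : 'rV[R]_n := \row_i (t ^+ r i * x 0 i).

Lemma dil1 x : dil 1 x = x.
Proof. by apply/rowP => i; rewrite mxE expr1n mul1r. Qed.

Lemma dil0 x : (forall i, 0 < r i)%N -> dil 0 x = 0.
Proof.
by move=> r0; apply/rowP => i; rewrite !mxE expr0n eqn0Ngt r0 mul0r.
Qed.

Lemma is_derive_exprn (m : nat) t :
  is_derive t 1 (fun s : R => s ^+ m) (m%:R * t ^+ m.-1).
Proof.
have -> : (fun s : R => s ^+ m) = (id ^+ m : R -> R) by rewrite exprfctE.
by apply: is_derive_eq; rewrite /GRing.scale/= mulr1 mulr_natl.
Qed.

Lemma is_derive_dil t x :
  is_derive t 1 (dil^~ x) (\row_i ((r i)%:R * t ^+ (r i).-1 * x 0 i)).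
Proof.
have H i : is_derive t 1 (fun s : R => s ^+ r i * x 0 i)
                       ((r i)%:R * t ^+ (r i).-1 * x 0 i).
  have := is_derive_exprn (r i) t.
  move=> D; have -> : (fun s : R => s ^+ r i * x 0 i) = (fun s => s ^+ r i) * cst (x 0 i) by [].
  by apply: is_derive_eq; rewrite scaler0 add0r /GRing.scale /=; ring.
have D : derivable (dil^~ x) t 1.
  apply/derivable_mxP => i j; rewrite ord1.
  have -> : (fun s => dil s x 0 j) = (fun s : R => s ^+ r j * x 0 j).
    by apply/funext => s; rewrite mxE.
  by [].
apply: DeriveDef => //; rewrite derive_mx//; apply/rowP => j; rewrite !mxE.
have -> : (fun s => dil s x 0 j) = (fun s : R => s ^+ r j * x 0 j).
  by apply/funext => s; rewrite mxE.
exact: derive_val.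
Qed.

(** Chain rule with $t\,\partial_t h_t(x) = \nabla^h(h_t(x))$; the factor [t] stays on the left so
    that nothing is divided by 0. *)
Lemma derive_along_dil (f : 'rV[R]_n -> R) t x :
  (forall y, differentiable f y) ->
  exists2 d : R, is_derive t 1 (fun s => f (dil s x)) d &
    t * d = 'D_(nablah R r (dil t x)) f (dil t x).
Proof.
move=> df; have D := is_derive_dil t x.
have dd : differentiable (dil^~ x) t by apply/derivable1_diffP.
exists ('d f (dil t x) ('D_1 (dil^~ x) t)).
  apply: DeriveDef.
    by apply: diff_derivable; exact: (differentiable_comp dd (df _)).
  rewrite deriveE; last exact: (differentiable_comp dd (df _)).
  by rewrite (diff_comp dd (df _)) /= (deriveE (1 : R) dd).
rewrite derive_val deriveE// -[LHS]/(t *: _) -linearZ; congr ('d _ _ _).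
rewrite nablahE; apply/rowP => i; rewrite !mxE.
by case: (r i) => [|k]; rewrite ?mul0r ?mulr0 ?exprS//=; ring.
Qed.

(** The derivative is controlled only strictly to the right of [s]: Euler's equation carries a
    factor [t] and is silent at 0, where continuity takes over. *)
Lemma is_derive0_eq (W : R -> R) (s t : R) : s <= t ->
  (forall u, s < u -> is_derive u 1 W 0) ->
  {within `[s, t], continuous W} -> W s = W t.
Proof.
move=> st dW cW; have [u|c _] := @MVT_segment _ W (cst 0) s t st _ cW.
  by rewrite in_itv => /andP[su _]; exact: dW.
by rewrite mul0r => /eqP; rewrite subr_eq0 => /eqP.
Qed.

(** The function $s^m f(h_s x)$ is constant on $[0,1]$, and its values at 1 and 0 are the two sides.
    The factor [0 ^+ m] covers both vanishing ([m > 0]) and constancy ([m = 0]). *)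
Lemma euler_nonpos (f : 'rV[R]_n -> R) (m : nat) x :
  (forall i, 0 < r i)%N -> (forall y, differentiable f y) ->
  (forall y, 'D_(nablah R r y) f y = - m%:R * f y) ->
  f x = 0 ^+ m * f 0.
Proof.
move=> r0 df Ef.
pose W (s : R) : R := s ^+ m * f (dil s x).
have dG s := derive_along_dil s x df.
have dW (s : R) : exists d : R, is_derive s 1 W
    (m%:R * s ^+ m.-1 * f (dil s x) + s ^+ m * d) /\
    s * d = 'D_(nablah R r (dil s x)) f (dil s x).
  have [d D E] := dG s; exists d; split => //.
  have Dm := is_derive_exprn m s.
  have -> : W = (fun s => s ^+ m) * (fun s => f (dil s x)) by [].
  apply: is_derive_eq.
  by rewrite /GRing.scale/=; ring.
have cW : {within `[0, 1], continuous W}.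
  apply: derivable_within_continuous => s _.
  by have [d [D _]] := dW s.
suff dW0 (s : R) : 0 < s -> is_derive s 1 W 0.
  have := is_derive0_eq ler01 dW0 cW.
  by rewrite /W dil1 dil0// expr1n mul1r.
move=> s0; have [d [D]] := dW s; rewrite Ef => E.
apply: is_derive_eq; apply: (@mulfI _ s); first by rewrite gt_eqF.
rewrite mulr0 mulrDr [s * (s ^+ m * d)]mulrCA E.
by case: (m) => [|k]; rewrite ?exprS/=; ring.
Qed.

(** Here $s^{-m} f(h_s x)$ is constant, on positive [s]. *)
Lemma euler_dil (f : 'rV[R]_n -> R) (m : nat) t x :
  (forall y, differentiable f y) ->
  (forall y, 'D_(nablah R r y) f y = m%:R * f y) -> 0 < t ->
  f (dil t x) = t ^+ m * f x.
Proof.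
move=> df Ef t0.
pose W (s : R) : R := s ^- m * f (dil s x).
have dW (s : R) : 0 < s -> is_derive s 1 W 0.
  move=> s0; have [d D E] := derive_along_dil s x df.
  have -> : W = (fun s => (s ^+ m)^-1) * (fun s => f (dil s x)).
    by apply/funext => u.
  have sm : s ^+ m != 0 by rewrite expf_neq0// gt_eqF.
  have Dm := is_derive_exprn m s.
  have Di : is_derive s 1 (fun u : R => (u ^+ m)^-1) (- (s ^+ m) ^- 2 * (m%:R * s ^+ m.-1)).
    apply: DeriveDef; first exact: derivableV.
    by rewrite deriveV// derive_val.
  apply: is_derive_eq; rewrite Ef in E.
  apply: (@mulfI _ s); first by rewrite gt_eqF.
  rewrite mulr0 mulrDr /GRing.scale/= mulrCA E.
  case: (m) sm => [|k] sm; rewrite /= ?exprS; first ring.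
  by field; rewrite expf_neq0 gt_eqF.
have W1 : W t = W 1.
  have H (s u : R) : 0 < s -> s <= u -> W s = W u.
    move=> s0 su; apply: is_derive0_eq => // [v sv|]; first by apply: dW; exact: lt_trans sv.
    apply: derivable_within_continuous => v; rewrite in_itv => /andP[sv _].
    by have := dW _ (lt_le_trans s0 sv).
  by case: (leP t 1) => [|/ltW] h; [exact: H|rewrite [RHS](H 1 t)].
move: W1; rewrite /W dil1 expr1n invr1 mul1r => <-.
by rewrite mulrA divff ?mul1r// expf_neq0// gt_eqF.
Qed.

(** Differentiating $f(h_t y) = t^m f(y)$ in $y^i$, and then in $t$ at 1, avoids exchanging second
    derivatives of [f], which is not yet known to be polynomial. *)
Lemma euler_pd (f : 'rV[R]_n -> R) (m : nat) i y :
  (forall y, differentiable f y) ->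
  (forall y, differentiable ('D_(delta_mx 0 i) f) y) ->
  (forall y, 'D_(nablah R r y) f y = m%:R * f y) ->
  'D_(nablah R r y) ('D_(delta_mx 0 i) f) y =
    (m%:R - (r i)%:R) * 'D_(delta_mx 0 i) f y.
Proof.
move=> df dg Ef; set g := 'D_(delta_mx 0 i) f.
have H t : 0 < t -> t ^+ r i * g (dil t y) = t ^+ m * g y.
  move=> t0.
  have lin : linear (dil t).
    by move=> a u v; apply/rowP => j; rewrite !mxE; ring.
  pose L : {linear 'rV[R]_n -> 'rV[R]_n} :=
    HB.pack (dil t) (GRing.isLinear.Build _ _ _ _ _ lin).
  have dL z : is_derive z (delta_mx 0 i : 'rV[R]_n) (f \o dil t) (t ^+ r i * g (dil t z)).
    have cL : continuous L.
      move=> u; apply: differentiable_continuous.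
      apply: differentiable_rV => j.
      have -> : (fun v : 'rV[R]_n => L v 0 j) = (fun v : 'rV[R]_n => t ^+ r j *: (v 0 j : R)).
        by apply/funext => v; rewrite mxE.
      by apply: differentiableZ; exact: differentiable_coord.
    have dLz : differentiable L z by exact: linear_differentiable.
    apply: DeriveDef.
      by apply: diff_derivable; exact: (@differentiable_comp _ _ _ _ L f z).
    rewrite deriveE; last exact: (@differentiable_comp _ _ _ _ L f z).
    rewrite (@diff_comp _ _ _ _ L f z)//.
    have E1 := congr1 (fun h => h (delta_mx 0 i)) (diff_lin z cL).
    transitivity ('d f (L z) (L (delta_mx 0 i))).
      by congr ('d f (L z) _); exact: E1.
    rewrite /g deriveE//.
    rewrite -[RHS]/(t ^+ r i *: _) -linearZ; congr ('d _ _ _).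
    apply/rowP => j; rewrite !mxE eqxx /=.
    by case: eqVneq => [->|]//; rewrite ?mulr0.
  have [_ <-] := dL y.
  have -> : f \o dil t = t ^+ m *: (f : 'rV[R]_n -> R).
    by apply/funext => z; rewrite /= (euler_dil _ df Ef).
  by rewrite deriveZ//; exact: diff_derivable.
have [d D E] := derive_along_dil 1 y dg.
rewrite !mul1r !dil1 in E; rewrite -E.
have D1 : is_derive (1 : R) 1 ((fun t : R => t ^+ r i) * (fun t => g (dil t y)))
    ((r i)%:R * g y + d).
  have D0 : is_derive (1 : R) 1 (fun u : R => u ^+ r i) ((r i)%:R).
    by have := is_derive_exprn (r i) 1; rewrite expr1n mulr1.
  apply: is_derive_eq; rewrite dil1 expr1n /GRing.scale/=; ring.
have D2 : is_derive (1 : R) 1 (fun t : R => t ^+ m * g y) (m%:R * g y).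
  have Dm := is_derive_exprn m 1.
  have -> : (fun t : R => t ^+ m * g y) = (fun t => t ^+ m) * cst (g y) by [].
  by apply: is_derive_eq; rewrite scaler0 !expr1n mulr1 /GRing.scale/=; ring.
have : (r i)%:R * g y + d = m%:R * g y.
  have [_ <-] := D1; have [_ <-] := D2.
  (* [H] holds for positive [t], hence near 1. *)
  apply: near_eq_derive.
  near=> t; apply: H; near: t; exact: lt_nbhsr.
move=> E2; apply: (addrI ((r i)%:R * g y)); rewrite E2 /g; ring.
Unshelve. all: by end_near. Qed.

Lemma smooth_diff X x : smooth X -> differentiable X x.
Proof. by move/(_ [::] x). Qed.

Lemma smooth_pd i X : smooth X -> smooth (pd i X).
Proof.
have -> : pd i X = 'D_(delta_mx 0 i) X by apply/funext => x; rewrite pdE.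
by move=> sX s x; have := sX (rcons s i) x; rewrite foldr_rcons.
Qed.

Lemma euler_lt0 X w j y : (forall i, 0 < r i)%N -> smooth X -> w < 0 ->
  (forall y, 'D_(nablah R r y) (fun z => X z 0 j) y = w%:~R * X y 0 j) ->
  X y 0 j = 0.
Proof.
move=> r0 sX w0 EX.
rewrite (@euler_nonpos (fun z => X z 0 j) `|w|%N y r0).
- by rewrite expr0n absz_eq0 lt_eqF// mul0r.
- by move=> z; apply: differentiable_entry; exact: smooth_diff.
- move=> z; rewrite EX; congr (_ * _).
  by rewrite -[in LHS](opprK w) -(ltr0_norm w0) mulrNz -abszE.
Qed.

Lemma euler_eq0 X j y : (forall i, 0 < r i)%N -> smooth X ->
  (forall y, 'D_(nablah R r y) (fun z => X z 0 j) y = 0) ->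
  X y 0 j = X 0 0 j.
Proof.
move=> r0 sX EX.
rewrite (@euler_nonpos (fun z => X z 0 j) 0 y r0) ?mul1r//.
- by move=> z; apply: differentiable_entry; exact: smooth_diff.
- by move=> z; rewrite EX oppr0 mul0r.
Qed.

(* By induction on the weight, through Euler's identity
   [w f = sum_i r_i x_i (d_i f)] when [w > 0]. *)
Lemma euler_polyvf X w j : (forall i, 0 < r i)%N -> smooth X ->
  (forall y, 'D_(nablah R r y) (fun z => X z 0 j) y = w%:~R * X y 0 j) ->
  polyvf (fun y => X y 0 j *: delta_mx 0 j).
Proof.
move=> r0.
have H0 Y v : v <= 0 -> smooth Y ->
    (forall y, 'D_(nablah R r y) (fun z => Y z 0 j) y = v%:~R * Y y 0 j) ->
    polyvf (fun y => Y y 0 j *: delta_mx 0 j).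
  rewrite le_eqVlt => /predU1P[->|v0] sY EY.
    have -> : (fun y => Y y 0 j *: delta_mx 0 j) =
        cst (Y 0 0 j *: delta_mx 0 j) :> vfield R n.
      apply/funext => y; rewrite (euler_eq0 y r0 sY)// => z.
      by rewrite EY mul0r.
    exact: polyvf_cst.
  have -> : (fun y => Y y 0 j *: delta_mx 0 j) = 0 :> vfield R n.
    by apply/funext => y; rewrite (euler_lt0 y r0 sY v0 EY) scale0r.
  exact: polyvf0.
have [|w0] := leP w 0; first exact: H0.
have [m ->] : exists m : nat, w = m%:Z by exists `|w|%N; rewrite gtz0_abs.
clear w w0.
elim/ltn_ind: m X => m IH X sX EX.
have [m0|m0] := posnP m; first by apply: H0 sX EX; rewrite m0.
have dX y : differentiable X y by exact: smooth_diff.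
have pX i : polyvf (fun y => pd i X y 0 j *: delta_mx 0 j).
  have sdX := smooth_pd i sX.
  have EdX y : 'D_(nablah R r y) (fun z => pd i X z 0 j) y =
      (m%:Z - (r i)%:Z)%:~R * pd i X y 0 j.
    have Ej : (fun z => pd i X z 0 j) = 'D_(delta_mx 0 i) (fun z => X z 0 j).
      by apply/funext => z; rewrite pdE derive_coord.
    rewrite Ej (@euler_pd _ m).
    - by rewrite pdE derive_coord// rmorphB.
    - by move=> z; exact: differentiable_entry.
    - by move=> z; rewrite -Ej; apply: differentiable_entry; exact: smooth_diff.
    - by move=> z; rewrite EX.
  have [mr|rm] := leqP m (r i).
    by apply: H0 sdX EdX; rewrite subr_le0 lez_nat.
  apply: (IH (m - r i)%N) => // [|y]; first by rewrite ltn_subrL r0 m0.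
  by rewrite EdX subzn// ltnW.
have -> : (fun y => X y 0 j *: delta_mx 0 j) =
  m%:R^-1 *: \sum_(i < n) (r i)%:R *: (fun y => y 0 i *: (pd i X y 0 j *: delta_mx 0 j))
  :> vfield R n.
  apply/funext => y.
  rewrite [RHS]/(_ *: _) fct_sumE.
  have -> : X y 0 j = m%:R^-1 * \sum_(i < n) (r i)%:R * (y 0 i * pd i X y 0 j).
    rewrite -[LHS](@mulKf _ (m%:R : R)) ?pnatr_eq0 -?lt0n// -EX; congr (_ * _).
    rewrite -derive_coord// derive_sum_pd// summxE; apply: eq_bigr => i _.
    by rewrite mxE nablahE mxE mulrA.
  rewrite -scalerA scaler_suml; congr (_ *: _).
  by apply: eq_bigr => i _; rewrite -!scalerA.
apply: polyvfZ; apply: polyvf_sum => i _; apply: polyvfZ; exact: polyvf_coordZ.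
Qed.

End EulerHomogeneous.

(** * Lie brackets *)

Section LieAlgebra.
Variables (R : realType) (n : nat).
Implicit Types (X Y Z : vfield R n) (x u : 'rV[R]_n) (i j : 'I_n).

Fact act_key : unit. Proof. by []. Qed.
(** The derivative of [Y] along [X] for the flat connection. Written with partial derivatives, it is
    linear in [X] without any regularity; [lie] is its commutator on polynomial fields. *)
Definition act X Y : vfield R n :=
  locked_with act_key (fun x => \sum_(i < n) X x 0 i *: pd i Y x).

Lemma actE X Y x : act X Y x = \sum_(i < n) X x 0 i *: pd i Y x.
Proof. by rewrite /act unlock. Qed.

Lemma deriveE_act X Y x : polyvf Y -> 'D_(X x) Y x = act X Y x.
Proof. by move=> pY; rewrite actE derive_sum_pd//; exact: polyvf_diff. Qed.

Lemma lieE X Y : polyvf X -> polyvf Y -> lie X Y = act X Y - act Y X.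
Proof. by move=> pX pY; apply/funext => x; rewrite /lie !deriveE_act. Qed.

Lemma actDl X Y Z : act (X + Y) Z = act X Z + act Y Z.
Proof.
apply/funext => x; rewrite !fctE !actE -big_split; apply: eq_bigr => i _.
by rewrite mxE scalerDl.
Qed.

Lemma actZl a X Z : act (a *: X) Z = a *: act X Z.
Proof.
apply/funext => x; rewrite !fctE !actE scaler_sumr; apply: eq_bigr => i _.
by rewrite mxE scalerA.
Qed.

Lemma actNl X Z : act (- X) Z = - act X Z.
Proof. by rewrite -scaleN1r actZl scaleN1r. Qed.

Lemma act0l Z : act 0 Z = 0.
Proof. by rewrite -[in LHS](scale0r 0) actZl scale0r. Qed.

Lemma actDr X Y Z : polyvf Y -> polyvf Z -> act X (Y + Z) = act X Y + act X Z.
Proof.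
move=> pY pZ; apply/funext => x; rewrite !fctE !actE -big_split.
by apply: eq_bigr => i _; rewrite (pdD i pY pZ) scalerDr.
Qed.

Lemma actZr a X Z : polyvf Z -> act X (a *: Z) = a *: act X Z.
Proof.
move=> pZ; apply/funext => x; rewrite !fctE !actE scaler_sumr.
by apply: eq_bigr => i _; rewrite (pdZ i a pZ) !scalerA mulrC.
Qed.

Lemma actNr X Z : polyvf Z -> act X (- Z) = - act X Z.
Proof. by move=> pZ; rewrite -scaleN1r actZr// scaleN1r. Qed.

Lemma actBl X Y Z : act (X - Y) Z = act X Z - act Y Z.
Proof. by rewrite actDl actNl. Qed.

Lemma actBr X Y Z : polyvf Y -> polyvf Z -> act X (Y - Z) = act X Y - act X Z.
Proof. by move=> pY pZ; rewrite (actDr _ pY (polyvfN pZ)) (actNr _ pZ). Qed.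

Lemma act_cstr X u : act X (cst u) = 0.
Proof.
apply/funext => x; rewrite !actE big1// => i _.
by rewrite pd_cst scaler0.
Qed.

Lemma act_dd i Y : act (dd R i) Y = pd i Y.
Proof.
apply/funext => x; rewrite !actE (bigD1 i)//= big1 => [|j ji].
  by rewrite mxE !eqxx scale1r addr0.
by rewrite mxE eqxx (negbTE ji) scale0r.
Qed.

Lemma polyvf_act X Y : polyvf X -> polyvf Y -> polyvf (act X Y).
Proof.
move=> pX pY.
have -> : act X Y = \sum_(i < n) (fun x => X x 0 i *: pd i Y x).
  by apply/funext => x; rewrite actE fct_sumE.
by apply: polyvf_sum => i _; apply: polyvf_mul => //; exact: polyvf_pd.
Qed.

Lemma pd_sum j (F : 'I_n -> vfield R n) : (forall i, polyvf (F i)) ->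
  pd j (\sum_(i < n) F i) = \sum_(i < n) pd j (F i).
Proof.
move=> pF; have : polyvf (\sum_(i < n) F i) /\
    pd j (\sum_(i < n) F i) = \sum_(i < n) pd j (F i).
  elim/big_rec2: _ => [|i X Y _ [pY E]]; first by rewrite pd0; split => //; exact: polyvf0.
  by rewrite pdD// E; split => //; exact: polyvfD.
by case.
Qed.

Lemma pd_act j X Y : polyvf X -> polyvf Y ->
  pd j (act X Y) = act (pd j X) Y + act X (pd j Y).
Proof.
move=> pX pY.
have -> : act X Y = \sum_(i < n) (fun x => X x 0 i *: pd i Y x).
  by apply/funext => x; rewrite actE fct_sumE.
rewrite pd_sum; last first.
  by move=> i; apply: polyvf_mul => //; exact: polyvf_pd.
apply/funext => x; rewrite fct_sumE.
transitivity (act (pd j X) Y x + act X (pd j Y) x); last by [].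
rewrite !actE -big_split.
apply: eq_bigr => i _; rewrite pd_entryZ; [|exact: polyvf_diff|exact/polyvf_diff/polyvf_pd].
by rewrite (pdC j i pY).
Qed.

(* [act] is a pre-Lie product: its associator is symmetric in the first two
   arguments because second partial derivatives commute. *)
Lemma act_assoc X Y Z : polyvf X -> polyvf Y -> polyvf Z ->
  act X (act Y Z) - act (act X Y) Z = act Y (act X Z) - act (act Y X) Z.
Proof.
have H X' Y' x : polyvf X' -> polyvf Y' -> polyvf Z ->
    (act X' (act Y' Z) - act (act X' Y') Z) x =
    \sum_(i < n) \sum_(j < n) (X' x 0 i * Y' x 0 j) *: pd i (pd j Z) x.
  move=> pX pY pZ.
  transitivity (act X' (act Y' Z) x - act (act X' Y') Z x); first by [].
  have -> : act X' (act Y' Z) x =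
      \sum_(i < n) (X' x 0 i *: act (pd i Y') Z x) +
      \sum_(i < n) (X' x 0 i *: act Y' (pd i Z) x).
    rewrite [LHS]actE -big_split; apply: eq_bigr => i _.
    by rewrite (pd_act i pY pZ) scalerDr.
  have -> : act (act X' Y') Z x = \sum_(i < n) (X' x 0 i *: act (pd i Y') Z x).
    rewrite [LHS]actE; under eq_bigr => j _.
      rewrite actE summxE scaler_suml.
      under eq_bigr do rewrite mxE -scalerA.
      over.
    rewrite exchange_big; apply: eq_bigr => i _.
    by rewrite actE scaler_sumr.
  rewrite addrAC subrr add0r; apply: eq_bigr => i _.
  rewrite actE scaler_sumr; apply: eq_bigr => j _.
  by rewrite scalerA (pdC i j pZ).
move=> pX pY pZ; apply/funext => x.
rewrite (H X Y x pX pY pZ) (H Y X x pY pX pZ) exchange_big.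
apply: eq_bigr => i _; apply: eq_bigr => j _.
by rewrite (pdC i j pZ) mulrC.
Qed.

Lemma polyvf_lie X Y : polyvf X -> polyvf Y -> polyvf (lie X Y).
Proof. by move=> pX pY; rewrite lieE//; apply: polyvfB; exact: polyvf_act. Qed.

Lemma lieC X Y : lie X Y = - lie Y X.
Proof. by apply/funext => x; rewrite opprfctE /lie opprB. Qed.

Lemma lieDl X Y Z : polyvf X -> polyvf Y -> polyvf Z ->
  lie (X + Y) Z = lie X Z + lie Y Z.
Proof.
move=> pX pY pZ; rewrite !lieE//; last exact: polyvfD.
by rewrite actDl actDr// opprD addrACA.
Qed.

Lemma lieZl a X Z : polyvf X -> polyvf Z -> lie (a *: X) Z = a *: lie X Z.
Proof.
move=> pX pZ; rewrite !lieE//; last exact: polyvfZ.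
by rewrite actZl actZr// scalerBr.
Qed.

Lemma lieDr X Y Z : polyvf X -> polyvf Y -> polyvf Z ->
  lie X (Y + Z) = lie X Y + lie X Z.
Proof. by move=> pX pY pZ; rewrite (lieC X) (lieDl pY pZ pX) opprD -!lieC. Qed.

Lemma lieZr a X Z : polyvf X -> polyvf Z -> lie X (a *: Z) = a *: lie X Z.
Proof. by move=> pX pZ; rewrite (lieC X) (lieZl a pZ pX) -scalerN -lieC. Qed.

Lemma lieNl X Z : polyvf X -> polyvf Z -> lie (- X) Z = - lie X Z.
Proof. by move=> pX pZ; rewrite -scaleN1r (lieZl _ pX pZ) scaleN1r. Qed.

Lemma lieNr X Z : polyvf X -> polyvf Z -> lie X (- Z) = - lie X Z.
Proof. by move=> pX pZ; rewrite -scaleN1r (lieZr _ pX pZ) scaleN1r. Qed.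

Lemma lie0l Z : polyvf Z -> lie 0 Z = 0.
Proof. by move=> pZ; rewrite lieE ?act0l ?(act_cstr Z 0) ?subrr//; exact: polyvf0. Qed.

Lemma lie0r Z : polyvf Z -> lie Z 0 = 0.
Proof. by move=> pZ; rewrite lieC lie0l ?oppr0. Qed.

Lemma lie_lieE X Y Z : polyvf X -> polyvf Y -> polyvf Z ->
  lie (lie X Y) Z = act (act X Y) Z - act (act Y X) Z -
                    (act Z (act X Y) - act Z (act Y X)).
Proof.
move=> pX pY pZ; have [pXY pYX] := (polyvf_act pX pY, polyvf_act pY pX).
rewrite (lieE pX pY) (lieE (polyvfB pXY pYX) pZ).
rewrite (actBr _ pXY pYX); congr (_ - _).
exact: actBl.
Qed.

(** The commutator of a pre-Lie product satisfies the Jacobi identity: the twelve double products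
    are unknowns ([xy_z] for $(xy)z$, [x_yz] for $x(yz)$) subject to three symmetries of the
    associator. *)
Lemma jacobi_of_assoc (V : zmodType)
    (xy_z yx_z z_xy z_yx xz_y zx_y y_xz y_zx yz_x zy_x x_yz x_zy : V) :
  x_yz - xy_z = y_xz - yx_z -> x_zy - xz_y = z_xy - zx_y ->
  y_zx - yz_x = z_yx - zy_x ->
  xy_z - yx_z - (z_xy - z_yx) =
  xz_y - zx_y - (y_xz - y_zx) - (yz_x - zy_x - (x_yz - x_zy)).
Proof.
move=> E1 E2 E3; apply/eqP; rewrite -subr_eq0; apply/eqP.
have -> : x_yz = y_xz - yx_z + xy_z by rewrite -E1 subrK.
have -> : x_zy = z_xy - zx_y + xz_y by rewrite -E2 subrK.
have -> : y_zx = z_yx - zy_x + yz_x by rewrite -E3 subrK.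
rewrite !opprB !opprD !opprK !addrA.
(* The permutation puts each term next to its opposite. *)
rewrite (ACl ((1*12)*(11*2)*(3*14)*(7*4)*(5*16)*(15*6)*(17*8)*(9*18)*(13*10)))/=.
by rewrite !subrr !addr0.
Qed.

Lemma jacobi X Y Z : polyvf X -> polyvf Y -> polyvf Z ->
  lie (lie X Y) Z = lie (lie X Z) Y + lie X (lie Y Z).
Proof.
move=> pX pY pZ; apply: etrans (lie_lieE pX pY pZ) _.
apply: etrans (jacobi_of_assoc (act_assoc pX pY pZ) (act_assoc pX pZ pY)
  (act_assoc pY pZ pX)) _.
have E := etrans (lieC X (lie Y Z)) (congr1 -%R (lie_lieE pY pZ pX)).
exact: esym (f_equal2 +%R (lie_lieE pX pZ pY) E).
Qed.

Lemma jacobi_ad X Y Z : polyvf X -> polyvf Y -> polyvf Z ->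
  lie X (lie Y Z) = lie (lie X Y) Z + lie Y (lie X Z).
Proof.
move=> pX pY pZ; have Vsub (V : zmodType) (a b c d : V) :
    a = b + c -> d = - b -> c = a + d by move=> -> ->; rewrite addrAC subrr add0r.
exact: (Vsub _ _ _ _ _ (jacobi pX pY pZ) (lieC Y (lie X Z))).
Qed.

Lemma lie_dd i Y : polyvf Y -> lie (dd R i) Y = pd i Y.
Proof.
move=> pY; rewrite lieE//; last exact: polyvf_cst.
by rewrite act_dd act_cstr subr0.
Qed.

Lemma polyvf_dd i : polyvf (dd R i).
Proof. exact: polyvf_cst. Qed.

Lemma polyvf_xdd i j : polyvf (xdd R i j).
Proof. exact: (polyvf_coordZ i (polyvf_cst _)). Qed.

Lemma pd_xdd k i j : pd k (xdd R i j) = (i == k)%:R *: dd R j.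
Proof.
apply: etrans (pd_polyvf_coordZ i k (polyvf_cst (delta_mx 0 j))) _.
apply/funext => x; rewrite pd_cst.
apply: etrans (_ : _ = (i == k)%:R *: delta_mx 0 j + x 0 i *: 0) _.
  by [].
by rewrite scaler0 addr0.
Qed.

End LieAlgebra.

(** * Weights *)

Section Grading.
Variables (R : realType) (n : nat) (r : 'I_n -> nat).
Hypothesis r0 : forall i, (0 < r i)%N.
Implicit Types (X Y Z : vfield R n) (x u : 'rV[R]_n) (i j : 'I_n) (k p : int).

Lemma polyvf_nablah : polyvf (nablah R r).
Proof. by apply: polyvf_sum => i _; apply: polyvfZ; exact: polyvf_xdd. Qed.

Lemma pd_nablah i : pd i (nablah R r) = (r i)%:R *: dd R i.
Proof.
rewrite pd_sum => [|j]; last by apply: polyvfZ; exact: polyvf_xdd.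
rewrite (bigD1 i)//= big1 => [|j ji]; rewrite pdZ ?pd_xdd; try exact: polyvf_xdd.
  by rewrite eqxx scale1r addr0.
by rewrite (negbTE ji) scale0r scaler0.
Qed.

Lemma act_nablah_entry X x j : act X (nablah R r) x 0 j = (r j)%:R * X x 0 j.
Proof.
rewrite actE summxE (bigD1 j)//= big1 => [|i ij]; rewrite pd_nablah !mxE eqxx.
  by rewrite eqxx mulr1 addr0 mulrC.
by rewrite eq_sym (negbTE ij) !mulr0.
Qed.

Lemma lie_nablah_entry X x j : polyvf X ->
  lie (nablah R r) X x 0 j = act (nablah R r) X x 0 j - (r j)%:R * X x 0 j.
Proof.
move=> pX; rewrite (lieE polyvf_nablah pX); apply: etrans (entryB _ _ x j) _.
by congr (_ - _); exact: act_nablah_entry.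
Qed.

(** Component [j] of $[\nabla^h, X] = kX$ is Euler's equation for $X^j$ with weight $k + r_j$, the
    shift coming from the derivative of $\nabla^h$ itself. *)
Lemma gh_polyvf k X : gh r k X -> polyvf X.
Proof.
move=> [sX EX].
have E j y : 'D_(nablah R r y) (fun z => X z 0 j) y = (k + (r j)%:Z)%:~R * X y 0 j.
  have := congr1 (fun F : vfield R n => F y 0 j) EX.
  rewrite /lie !mxE (deriveE_act X y polyvf_nablah) act_nablah_entry.
  rewrite derive_coord; last exact: smooth_diff.
  by rewrite intrD mulrDl => <-; rewrite -pmulrn subrK.
have -> : X = \sum_(j < n) (fun y => X y 0 j *: delta_mx 0 j).
  by apply/funext => y; rewrite fct_sumE -row_sum_delta.
by apply: polyvf_sum => j _; exact: (euler_polyvf r0 sX (E j)).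
Qed.

(** The working form of weight [k], from which analysis has disappeared. *)
Lemma ghP k X : gh r k X <-> polyvf X /\
  forall x j, act (nablah R r) X x 0 j = (k + (r j)%:Z)%:~R * X x 0 j.
Proof.
split=> [gX|[pX EX]].
  have pX := gh_polyvf gX; split => // x j.
  have := congr1 (fun F : vfield R n => F x 0 j) gX.2.
  rewrite lie_nablah_entry// entryZ intrD mulrDl => <-.
  by rewrite -pmulrn subrK.
split; first exact: polyvf_smooth.
apply/funext => x; apply/rowP => j.
by rewrite lie_nablah_entry// entryZ EX intrD mulrDl -pmulrn addrK.
Qed.

Lemma gh0 k : gh r k (0 : vfield R n).
Proof.
apply/ghP; split; first exact: polyvf0.
move=> x j; rewrite (act_cstr _ 0); by rewrite !mxE mulr0.
Qed.

Lemma ghD k X Y : gh r k X -> gh r k Y -> gh r k (X + Y).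
Proof.
move=> /ghP[pX EX] /ghP[pY EY]; apply/ghP; split; first exact: polyvfD.
move=> x j; rewrite (actDr _ pX pY); apply: etrans (entryD _ _ x j) _.
transitivity ((k + (r j)%:Z)%:~R * (X x 0 j + Y x 0 j)).
  by rewrite mulrDr -EX -EY.
by congr (_ * _); exact/esym/entryD.
Qed.

Lemma ghZ k a X : gh r k X -> gh r k (a *: X).
Proof.
move=> /ghP[pX EX]; apply/ghP; split; first exact: polyvfZ.
by move=> x j; rewrite (actZr _ _ pX) !entryZ EX mulrCA.
Qed.

Lemma ghN k X : gh r k X -> gh r k (- X).
Proof. by move=> gX; rewrite -scaleN1r; exact: ghZ. Qed.

Lemma ghB k X Y : gh r k X -> gh r k Y -> gh r k (X - Y).
Proof. by move=> gX gY; apply: ghD => //; exact: ghN. Qed.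

Lemma gh_lie k p X Y : gh r k X -> gh r p Y -> gh r (k + p) (lie X Y).
Proof.
move=> gX gY; have pX := gh_polyvf gX; have pY := gh_polyvf gY.
split; first exact/polyvf_smooth/polyvf_lie.
have pN := polyvf_nablah.
have := jacobi pN pX pY; rewrite gX.2 gY.2 (lieZl _ pX pY) (lieZl _ pY pX).
by rewrite (lieC Y X) scalerN intrD scalerDl => ->; rewrite addrAC addNr add0r.
Qed.

Lemma gh_dd i : gh r (- (r i)%:Z) (dd R i).
Proof.
apply/ghP; split; first exact: polyvf_dd.
move=> x j; rewrite act_cstr !mxE eqxx /=.
by case: eqVneq => [->|]; rewrite ?addNr ?mul0r ?mulr0.
Qed.

Lemma gh_xdd i j : gh r ((r i)%:Z - (r j)%:Z) (xdd R i j).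
Proof.
apply/ghP; split; first exact: polyvf_xdd.
move=> x k; rewrite actE summxE (bigD1 i)//= big1 => [|l li]; rewrite pd_xdd !mxE eqxx /=.
  rewrite ?eqxx ?mul1r addr0 nablahE !mxE.
  by have [->|_] := eqVneq k j; rewrite ?mulr0// subrK -pmulrn !mulr1.
by rewrite eq_sym (negbTE li) mul0r mulr0.
Qed.

Lemma gh_pd k i X : gh r k X -> gh r (k - (r i)%:Z) (pd i X).
Proof.
move=> gX; rewrite -lie_dd; last exact: gh_polyvf gX.
by rewrite addrC; apply: gh_lie => //; exact: gh_dd.
Qed.

Lemma gh_derive_nablah k X x j : gh r k X ->
  'D_(nablah R r x) (fun z => X z 0 j) x = (k + (r j)%:Z)%:~R * X x 0 j.
Proof.
move=> /ghP[pX EX]; rewrite -derive_coord; last exact: polyvf_diff.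
by rewrite deriveE_act.
Qed.

Lemma gh_entry_lt0 k X x j : gh r k X -> k + (r j)%:Z < 0 -> X x 0 j = 0.
Proof.
move=> gX kj; apply: (euler_lt0 x r0 gX.1 kj) => y.
exact: gh_derive_nablah.
Qed.

Lemma gh_entry_eq0 k X x j : gh r k X -> k + (r j)%:Z = 0 -> X x 0 j = X 0 0 j.
Proof.
move=> gX kj; apply: (euler_eq0 x r0 gX.1) => y.
by rewrite (gh_derive_nablah y j gX) kj mul0r.
Qed.

Lemma gh_cst_entry k X x j : gh r k X -> (forall i, pd i X = 0) ->
  k + (r j)%:Z != 0 -> X x 0 j = 0.
Proof.
move=> /ghP[pX EX] X0 kj.
have := EX x j; rewrite actE big1 => [|i _]; last by rewrite X0 scaler0.
move/esym/eqP; rewrite mxE mulf_eq0 intr_eq0 (negbTE kj) /=.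
by move/eqP.
Qed.

(** A component of weight 0 is constant by homogeneity; any other vanishes by Euler's identity, its
    partial derivatives being zero. *)
Lemma gh_cst k X : gh r k X -> (forall i, pd i X = 0) -> X = cst (X 0).
Proof.
move=> gX X0; apply/funext => x; apply/rowP => j /=.
have [kj|kj] := eqVneq (k + (r j)%:Z) 0; first exact: gh_entry_eq0 gX kj.
by rewrite !(gh_cst_entry _ gX).
Qed.

Lemma gh_lt k X : gh r k X -> (forall j, k + (r j)%:Z < 0) -> X = 0.
Proof.
move=> gX kr; apply/funext => x; apply/rowP => j.
by rewrite (gh_entry_lt0 x gX (kr j)) mxE.
Qed.

Lemma act_mulmx X Y (M : 'M[R]_n) : polyvf Y ->
  act X (fun x => Y x *m M) = (fun x => act X Y x *m M).
Proof.
move=> pY; apply/funext => x; rewrite !actE mulmx_suml; apply: eq_bigr => i _.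
by rewrite pd_mulmx// scalemxAl.
Qed.

(** A constant matrix keeps fields homogeneous when it joins only components of matching weight;
    both [prj] and [penult_der] are of this form. *)
Lemma gh_mulmx k p X (M : 'M[R]_n) : gh r k X ->
  (forall i j, M i j != 0 -> k + (r i)%:Z = p + (r j)%:Z) ->
  gh r p (fun x => X x *m M).
Proof.
move=> /ghP[pX EX] HM; apply/ghP; split; first exact: polyvf_mulmx.
move=> x j; rewrite act_mulmx// !mxE mulr_sumr; apply: eq_bigr => i _.
rewrite EX mulrA; have [->|/HM ->//] := eqVneq (M i j) 0.
by rewrite !mulr0.
Qed.

Lemma lie_sumr N X (F : 'I_N -> vfield R n) : polyvf X ->
  (forall q, polyvf (F q)) -> lie X (\sum_(q < N) F q) = \sum_(q < N) lie X (F q).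
Proof.
move=> pX; elim: N F => [|N IH] F pF.
  by rewrite !big_ord0 lie0r.
rewrite !big_ord_recr /= (lieDr pX _ (pF _)); first by rewrite IH.
by apply: polyvf_sum.
Qed.

Definition prj j X : vfield R n := fun x => X x *m delta_mx j j.

Lemma prjE j X x : prj j X x = X x 0 j *: delta_mx 0 j.
Proof.
apply/rowP => i; rewrite !mxE (bigD1 j)//= big1 => [|l lj]; rewrite !mxE ?eqxx ?addr0//=.
by rewrite (negbTE lj) mulr0.
Qed.

Lemma sum_prj X : X = \sum_(j < n) prj j X.
Proof.
apply/funext => x; rewrite fct_sumE [LHS]row_sum_delta.
by apply: eq_bigr => j _; rewrite prjE.
Qed.

Lemma gh_prj k j X : gh r k X -> gh r k (prj j X).
Proof.
move=> gX; apply: gh_mulmx gX _ => i l; rewrite mxE.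
by have [->|_] := eqVneq i j; have [->|_] := eqVneq l j; rewrite ?eqxx.
Qed.

(** Eigenvectors of $[\nabla^h, \cdot]$ for distinct eigenvalues: bracketing the relation with
    [nablah] and subtracting [w N] times the relation removes the last term. *)
Lemma gh_indep N (w : nat -> int) (Z : nat -> vfield R n) : injective w ->
  (forall q, (q < N)%N -> gh r (w q) (Z q)) ->
  \sum_(q < N) Z q = 0 -> forall q, (q < N)%N -> Z q = 0.
Proof.
move=> winj; elim: N Z => // N IH Z gZ E.
have E2 : \sum_(q < N.+1) (w q)%:~R *: Z q = 0.
  have pZ (q : 'I_N.+1) : polyvf (Z q) by apply: gh_polyvf (gZ q _).
  transitivity (lie (nablah R r) (\sum_(q < N.+1) Z q)); last first.
    by rewrite E lie0r//; exact: polyvf_nablah.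
  rewrite lie_sumr//; last exact: polyvf_nablah.
  by apply: eq_bigr => q _; rewrite (gZ q _).2.
have gZ' q : (q < N)%N -> gh r (w q) (Z q) by move=> qN; apply: gZ; exact: ltnW.
have ZE q : (q < N)%N -> Z q = 0.
  move=> qN.
  have : ((w q)%:~R - (w N)%:~R : R) *: Z q = 0.
    apply: (IH (fun q => ((w q)%:~R - (w N)%:~R : R) *: Z q)) => // [q' q'N|].
      by apply: ghZ; exact: gZ'.
    apply/funext => x; apply/rowP => j; rewrite fct_sumE summxE.
    have E0 : \sum_(q < N) Z q x 0 j + Z N x 0 j = 0.
      transitivity ((\sum_(q < N.+1) Z q) x 0 j); last by rewrite E mxE.
      by rewrite big_ord_recr /= entryD fct_sumE summxE.
    have E1 : \sum_(q < N) (w q)%:~R * Z q x 0 j + (w N)%:~R * Z N x 0 j = 0.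
      transitivity ((\sum_(q < N.+1) (w q)%:~R *: Z q) x 0 j); last by rewrite E2 mxE.
      rewrite big_ord_recr /= entryD entryZ fct_sumE summxE.
      by congr (_ + _); apply: eq_bigr => q' _; rewrite entryZ.
    transitivity (\sum_(q < N) ((w q)%:~R * Z q x 0 j) -
      (w N)%:~R * \sum_(q < N) Z q x 0 j).
      by rewrite mulr_sumr -sumrB; apply: eq_bigr => q' _; rewrite entryZ mulrBl.
    move/eqP: E0; move/eqP: E1; rewrite !addr_eq0 => /eqP -> /eqP ->.
    by rewrite mxE mulrN opprK addNr.
  move=> /eqP; rewrite scaler_eq0 -rmorphB intr_eq0 subr_eq0 (inj_eq winj).
  by rewrite ltn_eqF//= => /eqP.
move=> q; rewrite ltnS leq_eqVlt => /predU1P[->|]; last exact: ZE.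
move: E; rewrite big_ord_recr /= big1 ?add0r// => q' _; exact: ZE.
Qed.

End Grading.

(** * The nilpotent algebra m and the gluing of graded maps on it *)

Section NegativePart.
Variables (R : realType) (n : nat) (r : 'I_n.+1 -> nat).
Hypothesis r0 : forall i, (0 < r i)%N.
Hypothesis rmax : forall i, (r i <= r ord_max)%N.
Implicit Types (X Y Z : vfield R n.+1) (i j : 'I_n.+1) (k p : int).

Lemma gh_neg_eq0 p X : gh r p X -> p < - (r ord_max)%:Z -> X = 0.
Proof.
move=> gX pr; apply: (gh_lt r0 gX) => j.
by have := rmax j; rewrite -lez_nat; lia.
Qed.

Lemma mneg_polyvf X : mneg r X -> polyvf X.
Proof.
by move=> [Z [gZ ->]]; apply: polyvf_sum => q _; exact: (gh_polyvf r0 (gZ q)).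
Qed.

Lemma mneg_gh p X : p < 0 -> gh r p X -> mneg r X.
Proof.
move=> p0 gX; have [q pq] : exists q : nat, p = - (q.+1)%:Z.
  by exists (`|p|.-1)%N; lia.
have [qr|rq] := ltnP q (r ord_max); last first.
  have -> : X = 0 by apply: (gh_neg_eq0 gX); rewrite pq; lia.
  exists (fun _ => 0); split; last by rewrite big1.
  by move=> q'; exact: gh0.
exists (fun q' : 'I_(r ord_max) => if q' == Ordinal qr then X else 0); split.
  move=> q'; have [->|_] := eqVneq; last exact: gh0.
  by rewrite /= -pq.
by rewrite -big_mkcond big_pred1_eq.
Qed.

Lemma mneg0 : mneg r (0 : vfield R n.+1).
Proof. by apply: (@mneg_gh (-1)) => //; exact: gh0. Qed.

Lemma mnegP a X Y : mneg r X -> mneg r Y -> mneg r (a *: X + Y).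
Proof.
move=> [Z [gZ ->]] [Z' [gZ' ->]]; exists (fun q => a *: Z q + Z' q); split.
  by move=> q; apply: ghD => //; exact: ghZ.
by rewrite big_split scaler_sumr.
Qed.

Lemma mnegD X Y : mneg r X -> mneg r Y -> mneg r (X + Y).
Proof. by move=> mX mY; rewrite -(scale1r X); exact: mnegP. Qed.

Lemma mneg_ind (P : vfield R n.+1 -> Prop) :
  (forall p X, p < 0 -> gh r p X -> P X) ->
  (forall X Y, mneg r X -> mneg r Y -> P X -> P Y -> P (X + Y)) ->
  forall X, mneg r X -> P X.
Proof.
move=> Pgh PD _ [Z [gZ ->]].
suff [] : mneg r (\sum_(q < r ord_max) Z q) /\ P (\sum_(q < r ord_max) Z q) by [].
elim/big_ind: _ => [|X Y [mX PX] [mY PY]|q _].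
- by split; [exact: mneg0|apply: (Pgh (-1)) => //; exact: gh0].
- by split; [exact: mnegD|exact: PD].
- by split; [apply: mneg_gh (gZ q)|apply: Pgh (gZ q)].
Qed.

Lemma mneg_lie X Y : mneg r X -> mneg r Y -> mneg r (lie X Y).
Proof.
move=> + mY; elim/mneg_ind => [p Z p0 gZ|Z Z' mZ mZ' IZ IZ']; last first.
  by rewrite lieDl; [exact: mnegD|exact: mneg_polyvf..].
elim/mneg_ind: mY => [p' Z' p'0 gZ'|Z1 Z2 mZ1 mZ2 I1 I2]; last first.
  by rewrite lieDr; [exact: mnegD|exact: gh_polyvf gZ|exact: mneg_polyvf..].
by apply: mneg_gh (gh_lie r0 gZ gZ'); rewrite -[0]addr0 ltrD.
Qed.

Lemma mneg_unique (Z Z' : 'I_(r ord_max) -> vfield R n.+1) :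
  (forall q : 'I_(r ord_max), gh r (- (q.+1)%:Z) (Z q)) ->
  (forall q : 'I_(r ord_max), gh r (- (q.+1)%:Z) (Z' q)) ->
  \sum_(q < r ord_max) Z q = \sum_(q < r ord_max) Z' q -> Z = Z'.
Proof.
move=> gZ gZ' E.
pose W (q : nat) : vfield R n.+1 :=
  oapp (fun q' => Z q' - Z' q') 0 (insub q).
have WE (q : 'I_(r ord_max)) : W q = Z q - Z' q by rewrite /W valK.
apply/funext => q; apply/eqP; rewrite -subr_eq0 -WE; apply/eqP.
apply: (@gh_indep _ _ r r0 (r ord_max) (fun q => - (q.+1)%:Z) W) => //.
- by move=> a b; lia.
- move=> a ar; rewrite -[a]/(val (Ordinal ar)) WE; exact: (ghB r0 (gZ _) (gZ' _)).
- by under eq_bigr do rewrite WE; rewrite sumrB E subrr.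
Qed.

(* The graded pieces are given as relations because the identification of
   vector fields with elements of the tower is only available as one. *)
Lemma mhom_ext (A : lmodType R) (Psi : int -> vfield R n.+1 -> set A) :
  (forall p X, p < 0 -> gh r p X -> exists a, Psi p X a) ->
  (forall p X a b, p < 0 -> gh r p X -> Psi p X a -> Psi p X b -> a = b) ->
  (forall p X Y c a b, p < 0 -> gh r p X -> gh r p Y ->
     Psi p X a -> Psi p Y b -> Psi p (c *: X + Y) (c *: a + b)) ->
  exists2 v : vfield R n.+1 -> A, mhom r v &
    forall p X, p < 0 -> gh r p X -> Psi p X (v X).
Proof.
move=> Pex Pfun Plin.
have P0 p : p < 0 -> Psi p 0 0.
  move=> p0; have [a Pa] := Pex p 0 p0 (gh0 _ r0 p).
  have := Plin p 0 0 (-1) a a p0 (gh0 _ r0 p) (gh0 _ r0 p) Pa Pa.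
  by rewrite scaler0 addr0 scaleN1r addNr.
have [f fP] : exists f : int -> vfield R n.+1 -> A,
    forall p X, p < 0 -> gh r p X -> Psi p X (f p X).
  have /choice[g gP] : forall u : int * vfield R n.+1, exists a : A,
      u.1 < 0 -> gh r u.1 u.2 -> Psi u.1 u.2 a.
    move=> [p X]; have [[p0 gX]|H] := pselect (p < 0 /\ gh r p X).
      by have [a Pa] := Pex p X p0 gX; exists a.
    by exists 0 => p0 gX; exfalso; apply: H.
  by exists (fun p X => g (p, X)) => p X; exact: (gP (p, X)).
have /choice[c cP] : forall X, exists Z : 'I_(r ord_max) -> vfield R n.+1,
    mneg r X -> (forall q : 'I_(r ord_max), gh r (- (q.+1)%:Z) (Z q)) /\
      X = \sum_(q < r ord_max) Z q.
  move=> X; have [[Z HZ]|H] := pselect (mneg r X); first by exists Z.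
  by exists (fun _ => 0).
(* [c X] is a chosen homogeneous decomposition; [mneg_unique] makes the value independent of the
   choice, and [mhom] imposes 0 outside [m]. *)
pose v X := if `[< mneg r X >] then \sum_(q < r ord_max) f (- (q.+1)%:Z) (c X q) else 0.
have vE (Z : 'I_(r ord_max) -> vfield R n.+1) :
    (forall q : 'I_(r ord_max), gh r (- (q.+1)%:Z) (Z q)) ->
    v (\sum_(q < r ord_max) Z q) = \sum_(q < r ord_max) f (- (q.+1)%:Z) (Z q).
  move=> gZ; have mZ : mneg r (\sum_(q < r ord_max) Z q) by exists Z.
  rewrite /v asboolT//; have [gc Ec] := cP _ mZ.
  by rewrite (mneg_unique gc gZ (esym Ec)).
have f0 p : p < 0 -> f p 0 = 0.
  by move=> p0; apply: (Pfun p 0) => //; [exact: gh0|apply: fP => //; exact: gh0|exact: P0].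
exists v.
  split=> [a X Y mX mY|X mX]; last by rewrite /v asboolF.
  have [gX EX] := cP _ mX; have [gY EY] := cP _ mY.
  have -> : a *: X + Y = \sum_(q < r ord_max) (a *: c X q + c Y q).
    by rewrite big_split -scaler_sumr -EX -EY.
  rewrite vE => [|q]; last by apply: ghD => //; exact: ghZ.
  rewrite {2}EX {2}EY !vE// scaler_sumr -big_split; apply: eq_bigr => q _.
  have q0 : - (q.+1)%:Z < 0 by [].
  apply: (Pfun _ (a *: c X q + c Y q) _ _ q0).
  - by apply: ghD => //; exact: ghZ.
  - by apply: fP => //; apply: ghD => //; exact: ghZ.
  - by apply: Plin => //; exact: fP.
move=> p X p0 gX; have [q pq] : exists q : nat, p = - (q.+1)%:Z.
  by exists (`|p|.-1)%N; lia.
have [qr|rq] := ltnP q (r ord_max); last first.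
  have -> : X = 0 by apply: (gh_neg_eq0 gX); rewrite pq; lia.
  have := vE (fun _ => 0) (fun q => gh0 _ r0 _); rewrite big1// => ->.
  by rewrite big1; [exact: P0|move=> q' _; exact: f0].
pose Z (q' : 'I_(r ord_max)) := if q' == Ordinal qr then X else 0.
have EZ : X = \sum_(q < r ord_max) Z q by rewrite -big_mkcond big_pred1_eq.
rewrite [in v X]EZ vE => [|q']; last first.
  rewrite /Z; have [->|_] := eqVneq; last exact: gh0.
  by rewrite /= -pq.
rewrite (bigD1 (Ordinal qr))//= big1 => [|q' /negbTE q'q]; last first.
  by rewrite /Z q'q; exact: f0.
by rewrite addr0 /Z eqxx -pq; exact: fP.
Qed.

End NegativePart.

(** * Derivations of m with values in vector fields *)

Section Derivations.
Variables (R : realType) (n : nat) (r : 'I_n.+1 -> nat).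
Hypothesis r0 : forall i, (0 < r i)%N.
Hypothesis rmax : forall i, (r i <= r ord_max)%N.
Implicit Types (X Y Z : vfield R n.+1) (i j a b c : 'I_n.+1) (k p : int).
Implicit Types D : vfield R n.+1 -> vfield R n.+1.

(** The counterpart of [derivations] with values in actual vector fields. Nothing is imposed outside
    [m], so that [lie X] itself qualifies. *)
Definition vder k D :=
  [/\ linear_on_m r D,
      forall p X, p < 0 -> gh r p X -> gh r (p + k) (D X)
    & forall X Y, mneg r X -> mneg r Y ->
        D (lie X Y) = lie (D X) Y + lie X (D Y)].

Lemma linear_on_m0 (A : lmodType R) (v : vfield R n.+1 -> A) :
  linear_on_m r v -> v 0 = 0.
Proof.
move=> lv; have m0 := mneg0 R r0 rmax; have := lv (-1) 0 0 m0 m0.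
by rewrite scaler0 addr0 scaleN1r addNr.
Qed.

Lemma linear_on_mD (A : lmodType R) (v : vfield R n.+1 -> A) X Y :
  linear_on_m r v -> mneg r X -> mneg r Y -> v (X + Y) = v X + v Y.
Proof. by move=> lv mX mY; have := lv 1 X Y mX mY; rewrite !scale1r. Qed.

Lemma linear_on_mZ (A : lmodType R) (v : vfield R n.+1 -> A) (t : R) X :
  linear_on_m r v -> mneg r X -> v (t *: X) = t *: v X.
Proof.
move=> lv mX; have := lv t X 0 mX (mneg0 R r0 rmax).
by rewrite linear_on_m0// !addr0.
Qed.

Lemma mneg_sum (I : Type) (s : seq I) (F : I -> vfield R n.+1) :
  (forall q, mneg r (F q)) -> mneg r (\sum_(i <- s) F i).
Proof.
move=> mF; elim/big_ind: _ => //; first exact: mneg0.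
by move=> X Y; exact: mnegD.
Qed.

Lemma linear_on_m_sum (A : lmodType R) (v : vfield R n.+1 -> A) (I : Type)
    (s : seq I) (F : I -> vfield R n.+1) :
  linear_on_m r v -> (forall q, mneg r (F q)) ->
  v (\sum_(i <- s) F i) = \sum_(i <- s) v (F i).
Proof.
move=> lv mF; elim: s => [|i s IH]; first by rewrite !big_nil linear_on_m0.
by rewrite !big_cons linear_on_mD// ?IH//; exact: mneg_sum.
Qed.

Lemma mneg_dd i : mneg r (dd R i).
Proof. by apply: (mneg_gh r0 rmax _ (gh_dd _ r0 i)); have := r0 i; lia. Qed.

Lemma mneg_xdd i j : (r i < r j)%N -> mneg r (xdd R i j).
Proof. by move=> rij; apply: (mneg_gh r0 rmax _ (gh_xdd _ r0 i j)); lia. Qed.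

Section Vder.
Variables (k : int) (D : vfield R n.+1 -> vfield R n.+1).
Hypothesis vD : vder k D.

Lemma vder_linear : linear_on_m r D. Proof. by case: vD. Qed.

Lemma vder_gh p X : p < 0 -> gh r p X -> gh r (p + k) (D X).
Proof. by case: vD => _ gD _; exact: gD. Qed.

Lemma vder_lie X Y : mneg r X -> mneg r Y ->
  D (lie X Y) = lie (D X) Y + lie X (D Y).
Proof. by case: vD => _ _; exact. Qed.

Lemma vder_polyvf X : mneg r X -> polyvf (D X).
Proof.
move: X; apply: (mneg_ind r0 rmax) => [p Y p0 gY|Y Z mY mZ pY pZ].
  exact: (gh_polyvf r0 (vder_gh p0 gY)).
by rewrite (linear_on_mD vder_linear)//; exact: polyvfD.
Qed.

End Vder.

Lemma vderB k D D' : vder k D -> vder k D' -> vder k (fun X => D X - D' X).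
Proof.
move=> vD vD'; split=> [a X Y mX mY|p X p0 gX|X Y mX mY].
- rewrite (vder_linear vD)// (vder_linear vD')// scalerBr opprD.
  by rewrite addrACA.
- exact: (ghB r0 (vder_gh vD p0 gX) (vder_gh vD' p0 gX)).
- have [pX pY] := (mneg_polyvf r0 mX, mneg_polyvf r0 mY).
  have [pDX pDY] := (vder_polyvf vD mX, vder_polyvf vD mY).
  have [pDX' pDY'] := (vder_polyvf vD' mX, vder_polyvf vD' mY).
  rewrite (vder_lie vD mX mY) (vder_lie vD' mX mY).
  rewrite (lieDl pDX (polyvfN pDX') pY) (lieDr pX pDY (polyvfN pDY')).
  by rewrite (lieNl pDX' pY) (lieNr pX pDY') opprD addrACA.
Qed.

Lemma vderD k D D' : vder k D -> vder k D' -> vder k (fun X => D X + D' X).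
Proof.
move=> vD vD'; split=> [a X Y mX mY|p X p0 gX|X Y mX mY].
- by rewrite (vder_linear vD)// (vder_linear vD')// scalerDr addrACA.
- exact: (ghD r0 (vder_gh vD p0 gX) (vder_gh vD' p0 gX)).
- have [pX pY] := (mneg_polyvf r0 mX, mneg_polyvf r0 mY).
  have [pDX pDY] := (vder_polyvf vD mX, vder_polyvf vD mY).
  have [pDX' pDY'] := (vder_polyvf vD' mX, vder_polyvf vD' mY).
  rewrite (vder_lie vD mX mY) (vder_lie vD' mX mY).
  by rewrite (lieDl pDX pDX' pY) (lieDr pX pDY pDY') addrACA.
Qed.

Lemma vder_ad k X : gh r k X -> vder k (lie X).
Proof.
move=> gX; have pX := gh_polyvf r0 gX.
split=> [a Y Z mY mZ|p Y p0 gY|Y Z mY mZ].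
- have [pY pZ] := (mneg_polyvf r0 mY, mneg_polyvf r0 mZ).
  by rewrite (lieDr pX (polyvfZ a pY) pZ) (lieZr a pX pY).
- by rewrite addrC; exact: gh_lie.
- have [pY pZ] := (mneg_polyvf r0 mY, mneg_polyvf r0 mZ).
  exact: jacobi_ad.
Qed.

(* The Poincare lemma for the closed family [D (dd i)]; by homogeneity the
   primitive is given by Euler's formula, with weight [k + r j > 0]. *)
Lemma vder_ad_dd k D : 0 <= k -> vder k D ->
  exists2 X, gh r k X & forall i, D (dd R i) = lie X (dd R i).
Proof.
move=> k0 vD; pose V i := D (dd R i).
have gV i : gh r (- (r i)%:Z + k) (V i).
  by apply: (vder_gh vD _ (gh_dd _ r0 i)); have := r0 i; lia.
have pV i := gh_polyvf r0 (gV i).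
(* [D] applied to $[\partial_i, \partial_j] = 0$ says that the family is closed. *)
have VC i j : pd i (V j) = pd j (V i).
  have := vder_lie vD (mneg_dd i) (mneg_dd j).
  have -> : lie (dd R i) (dd R j) = 0.
    by rewrite lie_dd ?pd_cst//; exact: polyvf_dd.
  rewrite (linear_on_m0 (vder_linear vD)) (lieC _ (dd R j)).
  rewrite (lie_dd j (pV i)) (lie_dd i (pV j)) addrC => /esym/eqP.
  by rewrite subr_eq0 => /eqP.
(* Closedness turns $\partial_j W$ into $(r_j + \nabla^h)V_j$, which multiplies component $a$ of
   $V_j$ by $k + r_a$. *)
pose W : vfield R n.+1 := \sum_i (r i)%:R *: (fun x : 'rV[R]_n.+1 => x 0 i *: V i x).
have pW : polyvf W.
  by apply: polyvf_sum => i _; apply: polyvfZ; exact: polyvf_coordZ.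
have pdW j : pd j W = (r j)%:R *: V j + act (nablah R r) (V j).
  rewrite pd_sum => [|i]; last by apply: polyvfZ; exact: polyvf_coordZ.
  apply/funext => x; rewrite fct_sumE.
  transitivity (\sum_i ((r i)%:R *: ((i == j)%:R *: V i x) +
                        (r i)%:R *: (x 0 i *: pd j (V i) x))).
    apply: eq_bigr => i _; rewrite (pdZ j _ (polyvf_coordZ i (pV i))).
    by rewrite (pd_polyvf_coordZ i j (pV i)) -scalerDr.
  rewrite big_split (bigD1 j)//= big1 => [|i /negbTE ->]; last first.
    by rewrite scale0r scaler0.
  rewrite eqxx scale1r addr0.
  transitivity ((r j)%:R *: V j x + act (nablah R r) (V j) x); last by [].
  congr (_ + _); rewrite actE; apply: eq_bigr => i _.
  by rewrite nablahE mxE scalerA VC.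
have kj j : (k + (r j)%:Z)%:~R != 0 :> R by rewrite intr_eq0; have := r0 j; lia.
have pdWE i x j : pd i W x 0 j = (k + (r j)%:Z)%:~R * V i x 0 j.
  rewrite pdW; apply: etrans (entryD _ _ x j) _.
  have [_ ->] := (ghP r0 _ _).1 (gV i).
  rewrite entryZ !intrD rmorphN /= -!pmulrn; ring.
(* Divides each component by its factor; the sign is that of $[X, \partial_i] = -\partial_i X$. *)
pose M : 'M[R]_n.+1 := diag_mx (\row_j (- ((k + (r j)%:Z)%:~R)^-1)).
have ME (u : 'rV[R]_n.+1) j : (u *m M) 0 j = - (u 0 j / (k + (r j)%:Z)%:~R).
  by rewrite mul_mx_diag !mxE mulrN.
pose X : vfield R n.+1 := fun x => W x *m M.
have pX : polyvf X by exact: polyvf_mulmx.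
have pdX i : pd i X = - V i.
  apply/funext => x; apply/rowP => j.
  rewrite (pd_mulmx i M pW) ME pdWE mxE mulrAC divff// mul1r.
  by [].
exists X; last first.
  move=> i; rewrite lieC (lie_dd i pX) pdX opprK.
  by [].
apply/(ghP r0); split => // x j.
rewrite actE summxE.
under eq_bigr => i _ do rewrite mxE pdX nablahE mxE.
rewrite [X x]/(W x *m M) ME /W fct_sumE summxE mulrN mulrCA divff// mulr1.
rewrite -sumrN; apply: eq_bigr => i _.
by rewrite !mxE; ring.
Qed.

Lemma pd_vder k D i Y : vder k D -> D (dd R i) = 0 -> mneg r Y ->
  pd i (D Y) = D (pd i Y).
Proof.
move=> vD Di mY; have pY := mneg_polyvf r0 mY.
have := vder_lie vD (mneg_dd i) mY.
by rewrite Di (lie0l pY) add0r (lie_dd i pY) (lie_dd i (vder_polyvf vD mY)).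
Qed.

Lemma act_xddl i j Y : act (xdd R i j) Y = (fun x => x 0 i *: pd j Y x).
Proof.
apply/funext => x; rewrite actE (bigD1 j)//= big1 => [|l lj].
  by rewrite !mxE !eqxx mulr1 addr0.
by rewrite !mxE (negbTE lj) mulr0 scale0r.
Qed.

Lemma lie_xdd i j a b :
  lie (xdd R i j) (xdd R a b) = (a == j)%:R *: xdd R i b - (i == b)%:R *: xdd R a j.
Proof.
rewrite lieE; [|exact: polyvf_xdd..]; rewrite !act_xddl !pd_xdd.
apply/funext => x; congr (_ - _); rewrite [RHS]/(_ *: _).
  by rewrite [LHS]scalerA [RHS]scalerA mulrC.
by rewrite [LHS]scalerA [RHS]scalerA mulrC.
Qed.

Lemma act_xddr a b Y x : act Y (xdd R a b) x = Y x 0 a *: delta_mx 0 b.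
Proof.
rewrite actE (bigD1 a)//= big1 => [|l la]; rewrite pd_xdd.
  by rewrite eqxx scale1r addr0.
by rewrite eq_sym (negbTE la) scale0r scaler0.
Qed.

Lemma lie_cst_xdd (u : 'rV[R]_n.+1) a b :
  lie (cst u) (xdd R a b) = u 0 a *: dd R b.
Proof.
rewrite lieE; [|exact: polyvf_cst|exact: polyvf_xdd].
by rewrite act_cstr subr0; apply/funext => x; rewrite act_xddr.
Qed.

End Derivations.

(** * Derivations that vanish on constant fields *)

Section KillsConstants.
Variables (R : realType) (n : nat) (r : 'I_n.+1 -> nat).
Hypothesis r0 : forall i, (0 < r i)%N.
Hypothesis rmax : forall i, (r i <= r ord_max)%N.
Variables (k : int) (D : vfield R n.+1 -> vfield R n.+1).
Hypotheses (k0 : 0 <= k) (vD : vder r k D) (Ddd : forall i, D (dd R i) = 0).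
Implicit Types (Y : vfield R n.+1) (i j a b c : 'I_n.+1) (p : int).

Let lD : linear_on_m r D := vder_linear vD.

Lemma vder_xdd_cst i j : (r i < r j)%N -> D (xdd R i j) = cst (D (xdd R i j) 0).
Proof.
move=> rij; have p0 : (r i)%:Z - (r j)%:Z < 0 by lia.
apply: (gh_cst r0 (vder_gh vD p0 (gh_xdd _ r0 i j))) => l.
rewrite (pd_vder r0 rmax vD (Ddd l) (mneg_xdd _ r0 rmax rij)) pd_xdd.
by rewrite (linear_on_mZ r0 rmax _ lD (mneg_dd _ r0 rmax j)) Ddd scaler0.
Qed.

(** The coefficient $u_{ij}^a$ of $\partial_a$ in the constant field $D(x^i\partial_j)$, read at the
    origin. *)
Let U i j a : R := D (xdd R i j) 0 0 a.

Lemma vder_xdd_wt i j a : (r i < r j)%N -> U i j a != 0 ->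
  (r a)%:Z + (r i)%:Z + k = (r j)%:Z.
Proof.
move=> rij; have p0 : (r i)%:Z - (r j)%:Z < 0 by lia.
have gD := vder_gh vD p0 (gh_xdd _ r0 i j).
have [|ne /eqP[]] := eqVneq ((r i)%:Z - (r j)%:Z + k + (r a)%:Z) 0; first by lia.
apply: (gh_cst_entry r0 0 gD _ ne) => l.
by rewrite vder_xdd_cst// pd_cst.
Qed.

(** Source of the three constraints below, obtained with [b = j], with [b] distinct from [i] and
    [j], and with [b = i]. *)
Lemma vder_xdd_rel i j a b c : (r i < r j)%N -> (r a < r b)%N ->
  D (lie (xdd R i j) (xdd R a b)) 0 0 c = U i j a * (c == b)%:R - U a b i * (c == j)%:R.
Proof.
move=> rij rab; have mij := mneg_xdd R r0 rmax rij; have mab := mneg_xdd R r0 rmax rab.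
rewrite (vder_lie vD mij mab) (vder_xdd_cst rij) (vder_xdd_cst rab).
rewrite (lieC (xdd R i j)) !lie_cst_xdd; apply: etrans (entryD _ _ 0 c) _.
by rewrite entryN !entryZ !mxE !eqxx.
Qed.

Lemma vder_xdd_sym i j a : (r i < r j)%N -> (r a < r j)%N -> U i j a = U a j i.
Proof.
move=> rij raj; have := @vder_xdd_rel i j a j j rij raj.
rewrite lie_xdd; have [aj|_] := eqVneq a j; first by move: raj; rewrite aj ltnn.
have [ij|_] := eqVneq i j; first by move: rij; rewrite ij ltnn.
rewrite !scale0r subrr (linear_on_m0 r0 rmax lD) eqxx !mulr1 mxE.
by move/esym/eqP; rewrite subr_eq0 => /eqP.
Qed.

(** If $r_a < r_b$, then $x^i\partial_j$ and $x^a\partial_b$ commute in [m], and the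
    $\partial_b$-component of the relation is [U i j a] alone. *)
Lemma vder_xdd_le i j a b : (r i < r j)%N -> U i j a != 0 ->
  b != j -> b != i -> (r b <= r a)%N.
Proof.
move=> rij Un0 bj bi; rewrite leqNgt; apply: contra Un0 => rab.
have wt := vder_xdd_wt rij.
have [//|Un0] := eqVneq (U i j a) 0; have {}wt := wt a Un0.
have := @vder_xdd_rel i j a b b rij rab.
(* [a = j] would force $r_i + k = 0$, although $r_i > 0$ and $k \ge 0$. *)
rewrite lie_xdd; have [aj|_] := eqVneq a j; first by move: wt; rewrite aj; have := r0 i; lia.
rewrite [i == b]eq_sym (negbTE bi) (negbTE bj).
rewrite !scale0r subrr (linear_on_m0 r0 rmax lD) eqxx mulr0 mulr1 subr0 mxE.
by move=> E; rewrite -E eqxx in Un0.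
Qed.

(** Otherwise [b = ord_max] is allowed in [vder_xdd_le] and gives $r_n \le r_a$, whereas the weights
    give $r_a < r_j \le r_n$. *)
Lemma vder_xdd_last i j a : (r i < r j)%N -> U i j a != 0 -> j = ord_max.
Proof.
move=> rij Un0; have wt := vder_xdd_wt rij Un0.
apply/eqP/negPn/negP => jz; have := rmax j; have := rmax i => riz rjz.
have zi : ord_max != i by apply/eqP => E; move: rij rjz; rewrite E; lia.
have := vder_xdd_le rij Un0 _ zi; rewrite eq_sym => /(_ jz).
have := r0 i; lia.
Qed.

(** If $r_a < r_i$, the image of $[x^i\partial_n, x^a\partial_i] = -x^a\partial_n$ has
    $\partial_i$-component both $u_{in}^a$ and $-u_{an}^i$; by symmetry $2u_{in}^a = 0$. *)
Lemma vder_xdd_ge i a : (r i < r ord_max)%N -> U i ord_max a != 0 -> (r i <= r a)%N.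
Proof.
move=> riz Un0; have wt := vder_xdd_wt riz Un0.
have raz : (r a < r ord_max)%N by have := r0 i; lia.
rewrite leqNgt; apply/negP => rai.
have := @vder_xdd_rel i ord_max a i i riz rai.
rewrite lie_xdd; have [az|_] := eqVneq a ord_max; first by move: raz; rewrite az ltnn.
have [iz|_] := eqVneq i ord_max; first by move: riz; rewrite iz ltnn.
rewrite eqxx scale0r scale1r sub0r mulr1 mulr0 subr0 -scaleN1r.
rewrite (linear_on_mZ r0 rmax _ lD (mneg_xdd _ r0 rmax raz)) entryZ.
rewrite -/(U a ord_max i) -(vder_xdd_sym riz raz) mulN1r => /eqP.
by rewrite -subr_eq0 -opprD oppr_eq0 -mulr2n mulrn_eq0 /= (negbTE Un0).
Qed.

(** Symmetry lets [vder_xdd_ge] be used in both directions, so $r_i = r_a$; this also extends the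
    bound of [vder_xdd_le] to the excluded index [b = i]. *)
Lemma vder_xdd_neq0 i j a : (r i < r j)%N -> U i j a != 0 ->
  [/\ j = ord_max, r i = r a, forall b, b != ord_max -> (r b <= r a)%N
    & (r ord_max)%:Z = 2 * (r a)%:Z + k].
Proof.
move=> rij Un0; have jz := vder_xdd_last rij Un0; subst j.
have wt := vder_xdd_wt rij Un0.
have raz : (r a < r ord_max)%N by have := r0 i; lia.
have Un0' : U a ord_max i != 0 by rewrite -(vder_xdd_sym rij raz).
have ria : r i = r a.
  by apply/eqP; rewrite eqn_leq (vder_xdd_ge rij Un0) (vder_xdd_ge raz Un0').
split => //; last by lia.
move=> b bz; have [->|bi] := eqVneq b i; first by rewrite ria.
exact: vder_xdd_le rij Un0 bz bi.
Qed.

(* A field [f dd_j] of [m] commutes with [x_c dd_j], which detects the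
   [c]-component of the constant field [D (f dd_j)]. *)
Lemma vder_eq0 : (forall i j, (r i < r j)%N -> D (xdd R i j) = 0) ->
  forall Y, mneg r Y -> D Y = 0.
Proof.
move=> Dx; apply: (mneg_ind r0 rmax); last first.
  by move=> Y Z mY mZ DY DZ; rewrite (linear_on_mD lD mY mZ) DY DZ addr0.
(* Induction on the weight, starting below $-r_n$ where all fields vanish: $\partial_l$ lowers the
   weight, so [D Z] has zero derivatives. *)
suff H (m : nat) p Y : p < 0 -> p < m%:Z - (r ord_max)%:Z -> gh r p Y -> D Y = 0.
  by move=> p Y p0; apply: (H (r ord_max)) => //; lia.
elim: m p Y => [|m IH] p Y p0 pm gY.
  rewrite (gh_neg_eq0 r0 rmax gY) ?(linear_on_m0 r0 rmax lD)//; lia.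
have mneg_p (W : vfield R n.+1) : gh r p W -> mneg r W by exact: mneg_gh.
rewrite [Y]sum_prj (linear_on_m_sum r0 rmax _ lD) => [|j]; last first.
  by apply: mneg_p; exact: gh_prj.
apply: big1 => j _; have gj := gh_prj r0 j gY; have mj := mneg_p _ gj.
set Z := prj j Y in gj mj *.
have DC l : pd l (D Z) = 0.
  rewrite (pd_vder r0 rmax vD (Ddd l) mj).
  by apply: (IH (p - (r l)%:Z)); [have := r0 l; lia..|exact: gh_pd].
have gDZ := vder_gh vD p0 gj.
have [pj0|pj0|pj0] := ltgtP (p + (r j)%:Z) 0; last first.
- have -> : Z = Z 0 0 j *: dd R j.
    apply/funext => x; rewrite /Z [LHS]prjE (gh_entry_eq0 r0 x gY pj0).
    by congr (_ *: _); rewrite prjE !mxE !eqxx mulr1.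
  by rewrite (linear_on_mZ r0 rmax _ lD (mneg_dd _ r0 rmax j)) Ddd scaler0.
- rewrite (gh_cst r0 gDZ DC); apply/funext => x; apply/rowP => c.
  rewrite [RHS]mxE /=; have [kc|kc] := eqVneq (p + k + (r c)%:Z) 0; last first.
    exact: gh_cst_entry gDZ DC kc.
  (* From $p + k + r_c = 0$, $k \ge 0$ and $p + r_j > 0$; hence $x^c\partial_j$ lies in [m]. *)
  have rcj : (r c < r j)%N by lia.
  have mcj := mneg_xdd R r0 rmax rcj.
  have := vder_lie vD mj mcj; rewrite (Dx _ _ rcj).
  have -> : lie Z (xdd R c j) = 0.
    (* The coefficient of $\partial_j$ has weight $p + r_j$, so its $\partial_j$-derivative has
       weight $p < 0$ and vanishes. *)
    have pjZ : pd j Z = 0.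
      rewrite /Z (pd_mulmx j _ (gh_polyvf r0 gY)); apply/funext => y.
      rewrite -/(prj j (pd j Y) y) prjE (gh_entry_lt0 r0 y (gh_pd r0 j gY)) ?scale0r//.
      by rewrite subrK.
    rewrite (lieE (mneg_polyvf r0 mj) (polyvf_xdd R c j)) act_xddl pjZ.
    have -> : (fun y : 'rV[R]_n.+1 => y 0 c *: (0 : vfield R n.+1) y) = 0.
      by apply/funext => y; exact: scaler0.
    rewrite subr0; apply/funext => y; rewrite act_xddr /Z prjE !mxE eqxx.
    have [cj|_] := eqVneq c j; first by move: rcj; rewrite cj ltnn.
    by rewrite mulr0 scale0r.
  rewrite (linear_on_m0 r0 rmax lD) (lie0r (mneg_polyvf r0 mj)) addr0.
  rewrite (gh_cst r0 gDZ DC) lie_cst_xdd => /(congr1 (fun F : vfield R n.+1 => F 0 0 j)).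
  by rewrite entryZ !mxE !eqxx mulr1 => <-.
- have -> : Z = 0.
    apply/funext => x; rewrite /Z [LHS]prjE (gh_entry_lt0 r0 x gY pj0).
    by rewrite scale0r.
  exact: (linear_on_m0 r0 rmax lD).
Qed.

End KillsConstants.

(** * Classification by weight, and a derivation that is no vector field *)

Section Classification.
Variables (R : realType) (n : nat) (r : 'I_n.+2 -> nat).
Hypothesis hr : signature r.
Implicit Types (X Y Z : vfield R n.+2) (i j a b c : 'I_n.+2) (k p : int).
Implicit Types D : vfield R n.+2 -> vfield R n.+2.

Local Notation z := (@ord_max n.+1).
Local Notation w := (@low n (@ord_max n)).

Lemma signature_gt0 i : (0 < r i)%N. Proof. by case: hr. Qed.

Lemma signature_max i : (r i <= r ord_max)%N.
Proof. by case: hr => _; apply; exact: leq_ord. Qed.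

Let r0 := signature_gt0.
Let rmax := signature_max.

Lemma low_neq_max (i : 'I_n.+1) : low i != ord_max.
Proof. by rewrite -val_eqE /= ltn_eqF. Qed.

Lemma neq_max_low b : b != ord_max -> exists i : 'I_n.+1, b = low i.
Proof.
move=> bz; have bn : (b < n.+1)%N.
  by have := ltn_ord b; rewrite ltnS leq_eqVlt => /predU1P[E|//]; case/eqP: bz; exact: val_inj.
by exists (Ordinal bn); exact: val_inj.
Qed.

Lemma signature_penult b : b != ord_max -> (r b <= r_penult r)%N.
Proof. by move=> /neq_max_low[i ->]; case: hr => _; apply; exact: (leq_ord i). Qed.

Lemma vder_subad k X D : gh r k X -> vder r k D -> vder r k (fun Y => D Y - lie X Y).
Proof. by move=> gX vD; exact: (vderB r0 rmax vD (vder_ad r0 gX)). Qed.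

Lemma vder_penult_wt k D i j a : 0 <= k -> vder r k D ->
    (forall l, D (dd R l) = 0) -> (r i < r j)%N -> D (xdd R i j) 0 0 a != 0 ->
  [/\ j = ord_max, r i = r_penult r, r a = r_penult r & k = ell r].
Proof.
move=> k0 vD Ddd rij Un0.
have [jz ria H E] := vder_xdd_neq0 r0 rmax k0 vD Ddd rij Un0.
have az : a != ord_max by apply/eqP => az; rewrite az in E; have := r0 z; lia.
have raw : r a = r_penult r.
  apply/eqP; rewrite eqn_leq (signature_penult az) andTb.
  exact: (H _ (low_neq_max ord_max)).
split; rewrite ?ria//.
by rewrite /ell /r_last -raw; lia.
Qed.

Lemma vder_is_ad k D : 0 <= k -> k <> ell r -> vder r k D ->
  exists2 X, gh r k X & forall Y, mneg r Y -> D Y = lie X Y.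
Proof.
move=> k0 kl vD; have [X gX DX] := vder_ad_dd r0 rmax k0 vD.
exists X => // Y mY; apply/eqP; rewrite -subr_eq0; apply/eqP.
have vE := vder_subad gX vD.
have Edd i : D (dd R i) - lie X (dd R i) = 0 by rewrite DX subrr.
apply: (vder_eq0 r0 rmax k0 vE Edd _ mY) => i j rij.
rewrite (vder_xdd_cst r0 rmax k0 vE Edd rij); apply/funext => x; apply/rowP => a.
rewrite [RHS]mxE; apply/eqP/negPn/negP => Un0.
by have [_ _ _] := vder_penult_wt k0 vE Edd rij Un0.
Qed.

Lemma vder_second_kind D : 0 <= ell r -> vder r (ell r) D ->
  (forall i, D (dd R i) = 0) -> second_kind r D.
Proof.
move=> l0 vD Ddd.
(* From $r_n \ge 2r_{n-1} > r_{n-1}$: every $x^i\partial_n$ with $i < n$ lies in [m]. *)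
have riz (i : 'I_n.+1) : (r (low i) < r ord_max)%N.
  have := signature_penult (low_neq_max i); have := r0 w; move: l0.
  by rewrite /ell /r_penult /r_last; lia.
case: (vD) => lD gD dD; split => //.
exists (\matrix_(i, j) D (xdd R (low i) ord_max) 0 0 (low j)); split.
- apply/matrixP => i j; rewrite !mxE.
  exact: (vder_xdd_sym r0 rmax l0 vD Ddd).
- move=> i j; rewrite mxE => Un0.
  by have [_ -> ->] := vder_penult_wt l0 vD Ddd (riz i) Un0.
- move=> i j rij jz; rewrite (vder_xdd_cst r0 rmax l0 vD Ddd rij).
  apply/funext => x; apply/rowP => a; rewrite [RHS]mxE.
  apply/eqP/negPn/negP => Un0.
  by have [jz'] := vder_penult_wt l0 vD Ddd rij Un0; rewrite jz' eqxx in jz.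
- move=> i rlz; rewrite (vder_xdd_cst r0 rmax l0 vD Ddd rlz).
  apply/funext => x; rewrite fct_sumE; apply/rowP => a; rewrite summxE /=.
  have [->|/neq_max_low[b ->]] := eqVneq a ord_max.
    rewrite big1 => [|c _]; last first.
      by rewrite !mxE eq_sym (negbTE (low_neq_max c)) andbF mulr0.
    (* A nonzero coefficient on $\partial_n$ would force $r_n = r_{n-1}$. *)
    apply/eqP/negPn/negP => Un0.
    have [_ _ rz _] := vder_penult_wt l0 vD Ddd rlz Un0.
    by have := riz ord_max; rewrite rz /r_penult ltnn.
  rewrite (bigD1 b)//= big1 => [|c cb]; rewrite !mxE eqxx /=.
    by rewrite eqxx mulr1 addr0.
  case: eqVneq => [E'|_]; rewrite ?mulr0//.
  by case/eqP: cb; apply: val_inj; have := congr1 val E'.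
Qed.

Lemma vder_ad_second_kind D : 0 <= ell r -> vder r (ell r) D ->
  exists2 X, gh r (ell r) X & second_kind r (fun Y => D Y - lie X Y).
Proof.
move=> l0 vD; have [X gX DX] := vder_ad_dd r0 rmax l0 vD.
exists X; first exact: gX.
apply: (vder_second_kind l0 (vder_subad gX vD)) => i.
by rewrite DX subrr.
Qed.

Lemma second_kind_vder D : second_kind r D -> vder r (ell r) D.
Proof. by case. Qed.

(* The derivation of the second kind whose matrix has a single nonzero entry,
   [1] in position [(n-1, n-1)]. *)
Definition penult_der Y : vfield R n.+2 := fun x => pd w Y x *m delta_mx z w.

Lemma penult_derE Y x : penult_der Y x = pd w Y x 0 z *: delta_mx 0 w.
Proof.
apply/rowP => i; rewrite !mxE (bigD1 z)//= big1 => [|l lj]; rewrite !mxE ?eqxx ?addr0//=.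
by rewrite (negbTE lj) mulr0.
Qed.

(** The components of $\partial_n Y$ have weights $p - r_n + r_j < 0$: fields of [m] do not depend
    on $x^n$. *)
Lemma pd_last_mneg Y : mneg r Y -> pd z Y = 0.
Proof.
move: Y; apply: (mneg_ind r0 rmax) => [p Y p0 gY|Y Z mY mZ EY EZ].
  apply: (gh_lt r0 (gh_pd r0 z gY)) => j; have := rmax j; lia.
by rewrite (pdD z (mneg_polyvf r0 mY) (mneg_polyvf r0 mZ)) EY EZ addr0.
Qed.

(** Likewise $p - r_{n-1} + r_j < 0$ for $j < n$: only the last component may depend on
    $x^{n-1}$. *)
Lemma pd_penult_mneg Y x j : mneg r Y -> j != ord_max -> pd w Y x 0 j = 0.
Proof.
move=> mY jz; move: Y mY; apply: (mneg_ind r0 rmax) => [p Y p0 gY|Y Z mY mZ EY EZ].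
  apply: (gh_entry_lt0 r0 x (gh_pd r0 w gY)).
  by have := signature_penult jz; rewrite /r_penult; lia.
rewrite (pdD w (mneg_polyvf r0 mY) (mneg_polyvf r0 mZ)).
by apply: etrans (entryD _ _ x j) _; rewrite EY EZ addr0.
Qed.

Lemma act_pd_penult Y Z : mneg r Y -> mneg r Z -> act (pd w Y) Z = 0.
Proof.
move=> mY mZ; apply/funext => x; rewrite actE big1// => j _.
have [->|jz] := eqVneq j z; first by rewrite (pd_last_mneg mZ) scaler0.
by rewrite (pd_penult_mneg x mY jz) scale0r.
Qed.

(** The point is the symmetry of the right-hand side in [Y] and [Z]: these are the terms that must
    cancel in the Leibniz rule. *)
Lemma act_penult_der Y Z : mneg r Z ->
  act (penult_der Y) Z = (fun x => (pd w Y x 0 z * pd w Z x 0 z) *: delta_mx 0 z).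
Proof.
move=> mZ; apply/funext => x; rewrite actE (bigD1 w)//= big1 => [|j jw]; last first.
  by rewrite penult_derE !mxE (negbTE jw) andbF mulr0 scale0r.
rewrite addr0 penult_derE -scalerA !mxE !eqxx mulr1; congr (_ *: _).
apply/rowP => j; rewrite !mxE eqxx /=.
have [->|jz] := eqVneq j z; first by rewrite mulr1.
by rewrite mulr0 (pd_penult_mneg x mZ jz).
Qed.

(** Both sides of the Leibniz rule equal [act Y (penult_der Z) - act Z (penult_der Y)]: on the left
    by [act_pd_penult], on the right because the two remaining products agree by symmetry. *)
Lemma vder_penult_der : vder r (ell r) penult_der.
Proof.
split=> [t Y Z mY mZ|p Y p0 gY|Y Z mY mZ].
- have [pY pZ] := (mneg_polyvf r0 mY, mneg_polyvf r0 mZ).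
  rewrite /penult_der (pdD w (polyvfZ t pY) pZ) (pdZ w t pY).
  by apply/funext => x; rewrite mulmxDl -scalemxAl.
- apply: (gh_mulmx r0 (gh_pd r0 w gY)) => i j; rewrite mxE.
  have [->|_] := eqVneq i z; have [->|_] := eqVneq j w; rewrite ?eqxx// => _.
  by rewrite /ell /r_last /r_penult; lia.
- have [pY pZ] := (mneg_polyvf r0 mY, mneg_polyvf r0 mZ).
  have [wY wZ] := (polyvf_pd w pY, polyvf_pd w pZ).
  have pd0Y : polyvf (penult_der Y) by exact: polyvf_mulmx.
  have pd0Z : polyvf (penult_der Z) by exact: polyvf_mulmx.
  have E1 : pd w (lie Y Z) = act Y (pd w Z) - act Z (pd w Y).
    have actw Y' Z' : mneg r Y' -> mneg r Z' -> pd w (act Y' Z') = act Y' (pd w Z').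
      move=> mY' mZ'; have [pY' pZ'] := (mneg_polyvf r0 mY', mneg_polyvf r0 mZ').
      by rewrite (pd_act w pY' pZ') (act_pd_penult mY' mZ') add0r.
    rewrite (lieE pY pZ); apply: etrans (pdB w (polyvf_act pY pZ) (polyvf_act pZ pY)) _.
    by congr (_ - _); exact: actw.
  have -> : penult_der (lie Y Z) = act Y (penult_der Z) - act Z (penult_der Y).
    rewrite {1}/penult_der E1.
    rewrite (act_mulmx Y (delta_mx z w) wZ : act Y (penult_der Z) = _).
    rewrite (act_mulmx Z (delta_mx z w) wY : act Z (penult_der Y) = _).
    by apply/funext => x; exact: mulmxBl.
  have E2 : (fun x => (pd w Y x 0 z * pd w Z x 0 z) *: delta_mx 0 z) =
            (fun x => (pd w Z x 0 z * pd w Y x 0 z) *: delta_mx 0 z) :> vfield R n.+2.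
    by apply/funext => x; rewrite mulrC.
  have Vsub (V : zmodType) (a b c d l1 l2 : V) :
      c = d -> l1 = c - a -> l2 = b - d -> b - a = l1 + l2.
    by move=> -> -> ->; rewrite [RHS]addrC subrKA.
  apply: (Vsub _ _ _ _ _ _ _ E2).
    by rewrite (lieE pd0Y pZ); congr (_ - _); exact: act_penult_der.
  by rewrite (lieE pY pd0Z); congr (_ - _); exact: act_penult_der.
Qed.

(** Since [penult_der] kills the $\partial_i$, such an [X] would be constant of weight $\ell \ge 0$,
    hence zero; but $x^{n-1}\partial_n$ is sent to $\partial_{n-1}$. *)
Lemma penult_der_not_ad X : 0 <= ell r -> gh r (ell r) X ->
  ~ (forall p Y, p < 0 -> gh r p Y -> penult_der Y = lie X Y).
Proof.
move=> l0 gX H; have pX := gh_polyvf r0 gX.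
have X0 : X = 0.
  have dX i : pd i X = 0.
    have := H _ _ _ (gh_dd R r0 i); rewrite (lieC X) (lie_dd i pX) => Hi.
    apply/eqP; rewrite -oppr_eq0 -Hi; last by have := r0 i; lia.
    by apply/eqP/funext => x; rewrite /penult_der pd_cst; exact: mul0mx.
  apply/funext => x; apply/rowP => j; rewrite [RHS]mxE.
  by apply: (gh_cst_entry r0 x gX dX); have := r0 j; lia.
have rwz : (r w < r z)%N.
  by move: l0; have := r0 w; rewrite /ell /r_last /r_penult; lia.
have := H _ _ _ (gh_xdd R r0 w z); rewrite X0 (lie0l (polyvf_xdd R w z)).
have p0 : (r w)%:Z - (r z)%:Z < 0 by lia.
move=> /(_ p0) /(congr1 (fun F : vfield R n.+2 => F 0 0 w)).
by rewrite penult_derE pd_xdd !mxE !eqxx /= !mulr1 => /eqP; rewrite oner_eq0.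
Qed.

End Classification.

(** * The Tanaka tower *)

Lemma addr_eqD (V : zmodType) (a b c a1 a2 b1 b2 c1 c2 : V) :
  a = a1 + a2 -> b = b1 + b2 -> c = c1 + c2 ->
  a1 = b1 + c1 -> a2 = b2 + c2 -> a = b + c.
Proof. by move=> -> -> -> -> ->; rewrite addrACA. Qed.

Lemma addr_eqB (V : zmodType) (a b c a1 a2 b1 b2 c1 c2 : V) :
  a = a1 + a2 -> b = b1 + b2 -> c = c1 + c2 ->
  a1 = b1 - c1 -> a2 = b2 - c2 -> a = b - c.
Proof. by move=> -> -> -> -> ->; rewrite opprD addrACA. Qed.

Section Tower.
Variables (R : realType) (n : nat) (r : 'I_n.+1 -> nat).
Hypothesis r0 : forall i, (0 < r i)%N.
Hypothesis rmax : forall i, (r i <= r ord_max)%N.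
Implicit Types (X Y Z : vfield R n.+1) (i p q : int) (l : nat) (t : R).
Implicit Types D : vfield R n.+1 -> vfield R n.+1.

Lemma mhom_eq (A : lmodType R) (v v' : vfield R n.+1 -> A) :
  mhom r v -> mhom r v' ->
  (forall p X, p < 0 -> gh r p X -> v X = v' X) -> v = v'.
Proof.
move=> [lv zv] [lv' zv'] E; apply/funext => X.
have [mX|mX] := pselect (mneg r X); last by rewrite zv// zv'.
move: X mX; apply: (mneg_ind r0 rmax) => // X Y mX mY EX EY.
by rewrite (linear_on_mD lv mX mY) (linear_on_mD lv' mX mY) EX EY.
Qed.

(* The elements of the tower on which the bracket with m is bilinear. *)
Fixpoint tok l : tower R n.+1 l -> Prop :=
  match l return tower R n.+1 l -> Prop with
  | 0 => fun u => polyvf u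
  | l'.+1 => fun u => @tok l' u.1 /\ linear_on_m r u.2
  end.

Lemma tokP l t (u v : tower R n.+1 l) : tok u -> tok v -> tok (t *: u + v).
Proof.
elim: l u v => [|l IH] u v /=.
  by move=> pu pv; apply: polyvfD => //; exact: polyvfZ.
move=> [u1 u2] [v1 v2]; split; first exact: IH.
move=> a X Y mX mY.
transitivity (t *: u.2 (a *: X + Y) + v.2 (a *: X + Y)); first by [].
transitivity (a *: (t *: u.2 X + v.2 X) + (t *: u.2 Y + v.2 Y)); last by [].
by rewrite (u2 _ _ _ mX mY) (v2 _ _ _ mX mY) !scalerDr addrACA !scalerA mulrC.
Qed.

Lemma tok0 l : tok (0 : tower R n.+1 l).
Proof.
elim: l => [|l IH] /=; first exact: polyvf0.
by split => // a X Y _ _ /=; rewrite scaler0 addr0.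
Qed.

Lemma tbrPl l t (u v : tower R n.+1 l) Y : tok u -> tok v -> mneg r Y ->
  tbr R l (t *: u + v) Y = t *: tbr R l u Y + tbr R l v Y.
Proof.
elim: l u v => [|l IH] u v /=.
  move=> pu pv mY; have pY := mneg_polyvf r0 mY.
  by rewrite (lieDl (polyvfZ t pu) pv pY) (lieZl t pu pY).
move=> [u1 u2] [v1 v2] mY.
rewrite (IH _ _ u1 v1 mY) -[RHS]/(_, _); congr (_, _).
  by rewrite /= scalerDr addrACA.
by rewrite /= scaler0 addr0.
Qed.

Lemma tbrPr l t (u : tower R n.+1 l) Y Z : tok u -> mneg r Y -> mneg r Z ->
  tbr R l u (t *: Y + Z) = t *: tbr R l u Y + tbr R l u Z.
Proof.
elim: l u => [|l IH] u /=.
  move=> pu mY mZ; have [pY pZ] := (mneg_polyvf r0 mY, mneg_polyvf r0 mZ).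
  by rewrite (lieDr pu (polyvfZ t pY) pZ) (lieZr t pu pY).
move=> [u1 u2] mY mZ.
rewrite (IH _ u1 mY mZ) u2// -[RHS]/(_, _); congr (_, _).
  by rewrite /= scalerDr addrACA.
by rewrite /= scaler0 addr0.
Qed.

Lemma tbr0 l Y : mneg r Y -> tbr R l 0 Y = 0.
Proof.
move=> mY; have := tbrPl (-1) (tok0 l) (tok0 l) mY.
by rewrite scaler0 addr0 scaleN1r addNr.
Qed.

Lemma tpart_tok l i (u : tower R n.+1 l) : tpart R r l i u -> tok u.
Proof.
elim: l u => [|l IH] u /=; first by case=> _; exact: gh_polyvf.
case: eqP => _ [u1 u2]; split.
- by rewrite u1; exact: tok0.
- by case: u2 => -[].
- exact: IH.
- by rewrite u2 => a X Y _ _ /=; rewrite scaler0 addr0.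
Qed.

(* The invariant of the induction on [l]: [temb] identifies the vector fields of
   weight [i < l] with the elements of [tpart l i]. *)
Record stage l : Prop := Stage {
  stage_ex : forall i X, i < l%:Z -> gh r i X ->
    exists2 a, temb R r l i X a & tpart R r l i a;
  stage_surj : forall i a, tpart R r l i a -> exists2 X, gh r i X & temb R r l i X a;
  stage_fun : forall i X a b, i < l%:Z -> gh r i X ->
    temb R r l i X a -> temb R r l i X b -> a = b;
  stage_inj : forall i X Y a, i < l%:Z -> gh r i X -> gh r i Y ->
    temb R r l i X a -> temb R r l i Y a -> X = Y;
  stage_lin : forall i t X Y a b, i < l%:Z -> gh r i X -> gh r i Y ->
    temb R r l i X a -> temb R r l i Y b -> temb R r l i (t *: X + Y) (t *: a + b);
  stage_lie : forall i p X Y a, i < l%:Z -> p < 0 -> gh r i X -> gh r p Y ->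
    temb R r l i X a -> temb R r l (i + p) (lie X Y) (tbr R l a Y) }.

Lemma stage0 : stage 0.
Proof.
split=> /=.
- by move=> i X i0 gX; exists X.
- by move=> i a [_ ga]; exists a.
- by move=> i X a b _ _ -> ->.
- by move=> i X Y a _ _ _ -> ->.
- by move=> i t X Y a b _ _ _ -> ->.
- by move=> i p X Y a _ _ _ _ ->.
Qed.

(** * Transport between tower-valued and field-valued derivations *)

Section StageTheory.
Variable l : nat.
Hypothesis Sl : stage l.

Lemma stage_part i X a : i < l%:Z -> gh r i X -> temb R r l i X a -> tpart R r l i a.
Proof.
move=> il gX ea; have [b eb pb] := stage_ex Sl il gX.
by rewrite (stage_fun Sl il gX ea eb).
Qed.

Lemma stage_sub i X Y a b : i < l%:Z -> gh r i X -> gh r i Y ->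
  temb R r l i X a -> temb R r l i Y b -> temb R r l i (X - Y) (a - b).
Proof.
move=> il gX gY ea eb; have := stage_lin Sl (-1) il gY gX eb ea.
by rewrite !scaleN1r [- Y + X]addrC [- b + a]addrC.
Qed.

(** The values on $\mathfrak{g}_p(h)$, $p < 0$, have weight [p + l], below [l]: exactly the range
    controlled by [stage l]. *)
Lemma from_vf_fun D (v v' : vfield R n.+1 -> tower R n.+1 l) :
  (forall p X, p < 0 -> gh r p X -> gh r (p + l%:Z) (D X)) ->
  from_vf r D v -> from_vf r D v' -> v = v'.
Proof.
move=> gD [hv ev] [hv' ev']; apply: mhom_eq => // p X p0 gX.
apply: (stage_fun Sl _ (gD p X p0 gX) (ev p X p0 gX) (ev' p X p0 gX)).
by rewrite gtrDr.
Qed.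

Lemma from_vf_inj D D' (v : vfield R n.+1 -> tower R n.+1 l) :
  (forall p X, p < 0 -> gh r p X -> gh r (p + l%:Z) (D X)) ->
  (forall p X, p < 0 -> gh r p X -> gh r (p + l%:Z) (D' X)) ->
  from_vf r D v -> from_vf r D' v ->
  forall p X, p < 0 -> gh r p X -> D X = D' X.
Proof.
move=> gD gD' [hv ev] [hv' ev'] p X p0 gX.
apply: (stage_inj Sl _ (gD p X p0 gX) (gD' p X p0 gX) (ev p X p0 gX) (ev' p X p0 gX)).
by rewrite gtrDr.
Qed.

(** Reduction to homogeneous pairs, the only ones on which [temb] can transport brackets. *)
Lemma vder_homog k D : linear_on_m r D ->
  (forall p X, p < 0 -> gh r p X -> gh r (p + k) (D X)) ->
  (forall p q X Y, p < 0 -> q < 0 -> gh r p X -> gh r q Y ->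
     D (lie X Y) = lie (D X) Y + lie X (D Y)) -> vder r k D.
Proof.
move=> lD gD HD.
have pD X : mneg r X -> polyvf (D X).
  move: X; apply: (mneg_ind r0 rmax) => [p X p0 gX|X Y mX mY pX pY].
    exact: (gh_polyvf r0 (gD _ _ p0 gX)).
  by rewrite (linear_on_mD lD mX mY); exact: polyvfD.
have poly := @mneg_polyvf R n r r0; have mlie := @mneg_lie R n r r0 rmax.
split => // X Y mX mY; move: X mX.
apply: (mneg_ind r0 rmax) => [p X p0 gX|X X' mX mX' EX EX']; last first.
  have [pX pX' pY] := And3 (poly _ mX) (poly _ mX') (poly _ mY).
  have E1 : D (lie (X + X') Y) = D (lie X Y) + D (lie X' Y).
    by rewrite (lieDl pX pX' pY); exact: (linear_on_mD lD (mlie _ _ _ _) (mlie _ _ _ _)).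
  have E2 : lie (D (X + X')) Y = lie (D X) Y + lie (D X') Y.
    by rewrite (linear_on_mD lD mX mX'); exact: (lieDl (pD _ mX) (pD _ mX') pY).
  have E3 := lieDl pX pX' (pD _ mY).
  exact: (addr_eqD E1 E2 E3 EX EX').
have mX := mneg_gh r0 rmax p0 gX.
move: Y mY; apply: (mneg_ind r0 rmax) => [q Y q0 gY|Y Y' mY mY' EY EY'].
  exact: (HD _ _ _ _ p0 q0 gX gY).
have [pX pY pY'] := And3 (poly _ mX) (poly _ mY) (poly _ mY').
have E1 : D (lie X (Y + Y')) = D (lie X Y) + D (lie X Y').
  by rewrite (lieDr pX pY pY'); exact: (linear_on_mD lD (mlie _ _ _ _) (mlie _ _ _ _)).
have E2 := lieDr (pD _ mX) pY pY'.
have E3 : lie X (D (Y + Y')) = lie X (D Y) + lie X (D Y').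
  by rewrite (linear_on_mD lD mY mY'); exact: (lieDr pX (pD _ mY) (pD _ mY')).
exact: (addr_eqD E1 E2 E3 EY EY').
Qed.

(** The same reduction in the tower, where bilinearity of the bracket is known on [tok] elements;
    homogeneous values are such. *)
Lemma gT_homog (v : vfield R n.+1 -> tower R n.+1 l) : mhom r v ->
  (forall p X, p < 0 -> gh r p X -> tpart R r l (p + l%:Z) (v X)) ->
  (forall p q X Y, p < 0 -> q < 0 -> gh r p X -> gh r q Y ->
     v (lie X Y) = tbr R l (v X) Y - tbr R l (v Y) X) -> gT R r l v.
Proof.
move=> hv gv Hv; have lv := hv.1; have poly := @mneg_polyvf R n r r0.
have tv X : mneg r X -> tok (v X).
  move: X; apply: (mneg_ind r0 rmax) => [p X p0 gX|X Y mX mY tX tY].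
    exact: (tpart_tok (gv _ _ p0 gX)).
  by rewrite (linear_on_mD lv mX mY) -[v X]scale1r; exact: tokP.
have brDl u u' Y : tok u -> tok u' -> mneg r Y ->
    tbr R l (u + u') Y = tbr R l u Y + tbr R l u' Y.
  by move=> tu tu' mY; have := tbrPl 1 tu tu' mY; rewrite !scale1r.
have brDr u Y Y' : tok u -> mneg r Y -> mneg r Y' ->
    tbr R l u (Y + Y') = tbr R l u Y + tbr R l u Y'.
  by move=> tu mY mY'; have := tbrPr 1 tu mY mY'; rewrite !scale1r.
have mlie := @mneg_lie R n r r0 rmax.
split => // X Y mX mY; move: X mX.
apply: (mneg_ind r0 rmax) => [p X p0 gX|X X' mX mX' EX EX']; last first.
  have E1 : v (lie (X + X') Y) = v (lie X Y) + v (lie X' Y).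
    rewrite (lieDl (poly _ mX) (poly _ mX') (poly _ mY)).
    exact: (linear_on_mD lv (mlie _ _ _ _) (mlie _ _ _ _)).
  have E2 : tbr R l (v (X + X')) Y = tbr R l (v X) Y + tbr R l (v X') Y.
    by rewrite (linear_on_mD lv mX mX'); exact: (brDl _ _ _ (tv _ mX) (tv _ mX') mY).
  exact: (addr_eqB E1 E2 (brDr _ _ _ (tv _ mY) mX mX') EX EX').
have mX := mneg_gh r0 rmax p0 gX.
move: Y mY; apply: (mneg_ind r0 rmax) => [q Y q0 gY|Y Y' mY mY' EY EY'].
  exact: (Hv _ _ _ _ p0 q0 gX gY).
have E1 : v (lie X (Y + Y')) = v (lie X Y) + v (lie X Y').
  rewrite (lieDr (poly _ mX) (poly _ mY) (poly _ mY')).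
  exact: (linear_on_mD lv (mlie _ _ _ _) (mlie _ _ _ _)).
have E3 : tbr R l (v (Y + Y')) X = tbr R l (v Y) X + tbr R l (v Y') X.
  by rewrite (linear_on_mD lv mY mY'); exact: (brDl _ _ _ (tv _ mY) (tv _ mY') mX).
exact: (addr_eqB E1 (brDr _ _ _ (tv _ mX) mY mY') E3 EY EY').
Qed.

(** [D Y] is the unique vector field matched with [v Y]; [mhom_ext] glues these choices, and
    [stage_lie] with [stage_inj] pulls back the Leibniz rule. *)
Lemma gT_vder (v : vfield R n.+1 -> tower R n.+1 l) : gT R r l v ->
  exists2 D, vder r l%:Z D & from_vf r D v.
Proof.
move=> [hv gv dv]; have lv := hv.1.
have pl p : p < 0 -> p + l%:Z < l%:Z by rewrite gtrDr.
have [p X p0 gX|p X a b p0 gX [ga ea] [gb eb]|p X Y t a b p0 gX gY [ga ea] [gb eb]|D [lD _] eD] :=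
  @mhom_ext R n r r0 rmax (GRing.Lmodule.clone R (vfield R n.+1) _)
    (fun p Y X => gh r (p + l%:Z) X /\ temb R r l (p + l%:Z) X (v Y)).
- by have [X' gX' eX'] := stage_surj Sl (gv _ _ p0 gX); exists X'.
- exact: (stage_inj Sl (pl p p0) ga gb ea eb).
- split; first by apply: (ghD r0) => //; exact: ghZ.
  rewrite lv; [|exact: (mneg_gh r0 rmax p0)..].
  exact: (stage_lin Sl t (pl p p0) ga gb ea eb).
have gD p X : p < 0 -> gh r p X -> gh r (p + l%:Z) (D X).
  by move=> p0 gX; have [] := eD p X p0 gX.
exists D; last by split => // p X p0 gX; have [] := eD p X p0 gX.
apply: (vder_homog lD gD) => p q X Y p0 q0 gX gY.
have [gDX eDX] := eD _ _ p0 gX; have [gDY eDY] := eD _ _ q0 gY.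
have pq0 : p + q < 0 by lia.
have [gDXY eDXY] := eD _ _ pq0 (gh_lie r0 gX gY).
have [mX mY] := (mneg_gh r0 rmax p0 gX, mneg_gh r0 rmax q0 gY).
have e1 := stage_lie Sl (pl p p0) q0 gDX gY eDX.
have e2 := stage_lie Sl (pl q q0) p0 gDY gX eDY.
have g1 := gh_lie r0 gDX gY; have g2 := gh_lie r0 gDY gX.
have E1 : p + l%:Z + q = p + q + l%:Z by rewrite addrAC.
have E2 : q + l%:Z + p = p + q + l%:Z by rewrite addrAC [q + p]addrC.
rewrite E1 in e1 g1; rewrite E2 in e2 g2.
have e := stage_sub (pl _ pq0) g1 g2 e1 e2.
rewrite dv// in eDXY.
rewrite (stage_inj Sl (pl _ pq0) gDXY (ghB r0 g1 g2) eDXY e).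
by rewrite (lieC X).
Qed.

(** The transport in the other direction: [stage_ex] provides the values, [stage_fun] their
    uniqueness. *)
Lemma vder_gT D : vder r l%:Z D ->
  exists2 v : vfield R n.+1 -> tower R n.+1 l, gT R r l v & from_vf r D v.
Proof.
move=> vD; have [lD gD dD] := vD.
have pl p : p < 0 -> p + l%:Z < l%:Z by rewrite gtrDr.
have [p X p0 gX|p X a b p0 gX [ea pa] [eb pb]|p X Y t a b p0 gX gY [ea pa] [eb pb]|v hv ev] :=
  @mhom_ext R n r r0 rmax (tower R n.+1 l)
    (fun p Y a => temb R r l (p + l%:Z) (D Y) a /\ tpart R r l (p + l%:Z) a).
- by have [a ea pa] := stage_ex Sl (pl p p0) (gD _ _ p0 gX); exists a.
- exact: (stage_fun Sl (pl p p0) (gD _ _ p0 gX) ea eb).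
- have := stage_lin Sl t (pl p p0) (gD _ _ p0 gX) (gD _ _ p0 gY) ea eb.
  have gXY : gh r p (t *: X + Y) by apply: (ghD r0) => //; exact: ghZ.
  rewrite -lD; [|exact: (mneg_gh r0 rmax p0)..] => e.
  by split => //; exact: (stage_part (pl p p0) (gD _ _ p0 gXY) e).
have eD p X : p < 0 -> gh r p X -> temb R r l (p + l%:Z) (D X) (v X).
  by move=> p0 gX; have [] := ev p X p0 gX.
exists v; last by split.
apply: gT_homog => // [p X p0 gX|p q X Y p0 q0 gX gY].
  by have [] := ev p X p0 gX.
have pq0 : p + q < 0 by lia.
have [mX mY] := (mneg_gh r0 rmax p0 gX, mneg_gh r0 rmax q0 gY).
have e := eD _ _ pq0 (gh_lie r0 gX gY).
have e1 := stage_lie Sl (pl p p0) q0 (gD _ _ p0 gX) gY (eD _ _ p0 gX).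
have e2 := stage_lie Sl (pl q q0) p0 (gD _ _ q0 gY) gX (eD _ _ q0 gY).
have g1 := gh_lie r0 (gD _ _ p0 gX) gY; have g2 := gh_lie r0 (gD _ _ q0 gY) gX.
have E1 : p + l%:Z + q = p + q + l%:Z by rewrite addrAC.
have E2 : q + l%:Z + p = p + q + l%:Z by rewrite addrAC [q + p]addrC.
rewrite E1 in e1 g1; rewrite E2 in e2 g2.
have e3 := stage_sub (pl _ pq0) g1 g2 e1 e2.
rewrite (dD _ _ mX mY) (lieC X) in e.
exact: (stage_fun Sl (pl _ pq0) (ghB r0 g1 g2) e e3).
Qed.

Lemma ghT_sub_gT : ghT R r l `<=` gT R r l.
Proof.
move=> v [X gX fv]; have [v' gv' fv'] := vder_gT (vder_ad r0 gX).
rewrite (from_vf_fun _ fv fv')// => p Y p0 gY.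
by rewrite addrC; exact: gh_lie.
Qed.

(** Only weight [l] is new. The hypothesis enters in surjectivity: each new element of the tower
    comes from a vector field. *)
Lemma stageS : gT R r l = ghT R r l -> stage l.+1.
Proof.
move=> gTE; split=> /=.
- move=> i X il gX; case: eqP => [E|E].
    rewrite E in gX; have [v gv fv] := vder_gT (vder_ad r0 gX).
    by exists (0, v).
  have il' : i < l%:Z by lia.
  by have [a ea pa] := stage_ex Sl il' gX; exists (a, 0).
- move=> i [a1 a2]; case: eqP => [->|E] /= [E1 E2].
    have : ghT R r l a2 by rewrite -gTE.
    by move=> [X gX fX]; exists X.
  by have [X gX eX] := stage_surj Sl E1; exists X.
- move=> i X [a1 a2] [b1 b2] il gX; case: eqP => [E|E] /=.
    move=> [-> e2] [-> e2']; congr (_, _).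
    apply: (from_vf_fun _ e2 e2') => p Y p0 gY.
    by rewrite addrC; apply: gh_lie => //; rewrite -E.
  move=> [e1 ->] [e1' ->]; have il' : i < l%:Z by lia.
  by rewrite (stage_fun Sl il' gX e1 e1').
- move=> i X Y [a1 a2] il gX gY; case: eqP => [E|E] /=; last first.
    move=> [e1 _] [e1' _]; have il' : i < l%:Z by lia.
    exact: (stage_inj Sl il' gX gY e1 e1').
  rewrite E in gX gY => -[_ e2] [_ e2'].
  have glie W : gh r l%:Z W ->
      forall p Z, p < 0 -> gh r p Z -> gh r (p + l%:Z) (lie W Z).
    by move=> gW p Z p0 gZ; rewrite addrC; exact: gh_lie.
  have H := from_vf_inj (glie _ gX) (glie _ gY) e2 e2'.
  have [pX pY] := (gh_polyvf r0 gX, gh_polyvf r0 gY).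
  (* Equal brackets with the $\partial_j$ make [X - Y] constant, and a constant field of weight $l
     \ge 0$ is zero. *)
  have dXY j : pd j (X - Y) = 0.
    have rj : - (r j)%:Z < 0 by have := r0 j; lia.
    have := H _ _ rj (gh_dd R r0 j).
    rewrite (lieC X) (lieC Y) (lie_dd j pX) (lie_dd j pY) => /oppr_inj dE.
    by rewrite (pdB j pX pY) dE subrr.
  apply/eqP; rewrite -subr_eq0; apply/eqP/funext => x; apply/rowP => j.
  rewrite [RHS]mxE; apply: (gh_cst_entry r0 x (ghB r0 gX gY) dXY).
  by have := r0 j; lia.
- move=> i t X Y [a1 a2] [b1 b2] il gX gY; case: eqP => [E|E] /=; last first.
    move=> [e1 ->] [e1' ->]; have il' : i < l%:Z by lia.
    split; first exact: (stage_lin Sl t il' gX gY e1 e1').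
    by rewrite scaler0 addr0.
  rewrite E in gX gY => -[-> [[la za] ea]] [-> [[lb zb] eb]].
  split; first by rewrite scaler0 addr0.
  split; first split.
  - move=> s Z Z' mZ mZ'.
    transitivity (t *: a2 (s *: Z + Z') + b2 (s *: Z + Z')); first by [].
    transitivity (s *: (t *: a2 Z + b2 Z) + (t *: a2 Z' + b2 Z')); last by [].
    by rewrite (la _ _ _ mZ mZ') (lb _ _ _ mZ mZ') !scalerDr addrACA !scalerA mulrC.
  - move=> Z mZ; transitivity (t *: a2 Z + b2 Z); first by [].
    by rewrite (za _ mZ) (zb _ mZ) scaler0 addr0.
  - move=> p Z p0 gZ.
    have [pX pY pZ] := And3 (gh_polyvf r0 gX) (gh_polyvf r0 gY) (gh_polyvf r0 gZ).
    rewrite (lieDl (polyvfZ t pX) pY pZ) (lieZl t pX pZ).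
    have pl : p + l%:Z < l%:Z by rewrite gtrDr.
    have := stage_lin Sl t pl _ _ (ea p Z p0 gZ) (eb p Z p0 gZ).
    by apply; rewrite addrC; exact: gh_lie.
- move=> i p X Y [a1 a2] il p0 gX gY.
  have mY := mneg_gh r0 rmax p0 gY.
  (* Bracketing with [m] strictly lowers the weight, so the result lies below the top layer. *)
  have -> : (i + p == l%:Z) = false by apply/eqP; lia.
  case: eqP => [E|E] /= [E1 E2]; split => //.
    rewrite E1 (tbr0 l mY) add0r E addrC; case: E2 => _; exact.
  have il' : i < l%:Z by lia.
  by rewrite E2 addr0; exact: stage_lie.
Qed.

End StageTheory.

End Tower.

(** * Comparison of the two prolongations and the first wrong weight *)

Lemma msum_eq (R : realType) (n : nat) (r : 'I_n.+1 -> nat)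
    (S S' : forall k : nat, set (vfield R n.+1 -> tower R n.+1 k)) l :
  (forall k, S k = S' k) -> Defs.msum r S l = Defs.msum r S' l.
Proof.
move=> SS'; elim: l => //= l IH; apply/seteqP.
by split=> u /=; rewrite ?IH ?SS' // -?IH -?SS'.
Qed.

(** Equal sums give equal top layers once some element of the lower part is available to pair
    with. *)
Lemma msum_nonempty (R : realType) (n : nat) (r : 'I_n.+1 -> nat)
    (S : forall k : nat, set (vfield R n.+1 -> tower R n.+1 k)) l :
  (forall i, 0 < r i)%N -> (forall i, r i <= r ord_max)%N ->
  (forall k, (k < l)%N -> exists v, S k v) -> exists u, Defs.msum r S l u.
Proof.
move=> r0 rmax; elim: l => [_|l IH H]; first by exists 0; exact: mneg0.
have [k kl|u mu] := IH; first by apply: H; exact: ltnW.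
by have [v Sv] := H l (ltnSn l); exists (u, v).
Qed.

Section TanakaProlongation.
Variables (R : realType) (n : nat) (r : 'I_n.+2 -> nat).
Hypothesis hr : signature r.

Let r0 := signature_gt0 hr.
Let rmax := signature_max hr.

Lemma from_vf_ext k (D D' : vfield R n.+2 -> vfield R n.+2)
    (v : vfield R n.+2 -> tower R n.+2 k) :
  (forall Y, mneg r Y -> D Y = D' Y) -> from_vf r D v -> from_vf r D' v.
Proof.
move=> DD' [hv ev]; split=> // p Y p0 gY.
by rewrite -DD'; [exact: ev|exact: (mneg_gh r0 rmax p0 gY)].
Qed.

Lemma gT_eq_ghT k : stage R r k -> k%:Z <> ell r -> gT R r k = ghT R r k.
Proof.
move=> Sk kl; apply/seteqP; split; last exact: ghT_sub_gT.
move=> v /(gT_vder r0 rmax Sk)[D vD fv].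
have k0 : 0 <= k%:Z by [].
have [X gX DX] := vder_is_ad hr k0 kl vD.
by exists X; [exact: gX|exact: from_vf_ext fv].
Qed.

(** Only weights strictly below [l] must avoid [ell], so [l = ell] itself is reached. *)
Lemma stage_le l : (forall k, (k < l)%N -> k%:Z <> ell r) -> stage R r l.
Proof.
elim: l => [|l IH] kl; first exact: stage0.
have Sl : stage R r l by apply: IH => k /ltnW; exact: kl.
by apply: stageS => //; apply: gT_eq_ghT => //; exact: kl.
Qed.

(** The element matched with [penult_der]; were it also matched with some [lie X], injectivity would
    identify the two maps on [m]. *)
Lemma exists_not_vf l : l%:Z = ell r -> stage R r l ->
  exists2 v : vfield R n.+2 -> tower R n.+2 l, gT R r l v & ~ ghT R r l v.
Proof.
move=> lE Sl; have := vder_penult_der R hr; rewrite -lE => vD.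
have [v gv fv] := vder_gT r0 rmax Sl vD; exists v => // -[X gX fX].
have l0 : 0 <= ell r by rewrite -lE.
have gX' : gh r (ell r) X by rewrite -lE.
apply: (penult_der_not_ad hr l0 gX').
apply: (from_vf_inj Sl _ _ fv fX) => p Y p0 gY; first exact: (vder_gh vD).
by rewrite addrC; exact: gh_lie.
Qed.

Lemma gT_ell l : l%:Z = ell r -> stage R r l ->
  gT R r l =
    [set v | exists X : vfield R n.+2, exists D : vfield R n.+2 -> vfield R n.+2,
       [/\ gh r l%:Z X, second_kind r D
         & from_vf r (fun Y => lie X Y + D Y) v]].
Proof.
move=> lE Sl; have l0 : 0 <= ell r by rewrite -lE.
apply/seteqP; split=> v.
  move=> /(gT_vder r0 rmax Sl)[D vD fv].
  rewrite lE in vD; have [X gX kD] := vder_ad_second_kind hr l0 vD.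
  exists X, (fun Y => D Y - lie X Y); split; [by rewrite lE|exact: kD|].
  by apply: from_vf_ext fv => Y mY; rewrite addrC subrK.
move=> [X [D [gX kD fv]]].
have vN : vder r l%:Z (fun Y => lie X Y + D Y).
  by apply: (vderD r0 rmax (vder_ad r0 gX)); rewrite lE; exact: second_kind_vder.
have [v' gv' fv'] := vder_gT r0 rmax Sl vN.
by rewrite (from_vf_fun r0 rmax Sl (vder_gh vN) fv fv').
Qed.

End TanakaProlongation.

Theorem theorem2p2 (R : realType) (n : nat) (r : 'I_n.+2 -> nat)
    (hr : signature r) :
  (forall l : nat, l%:Z = ell r ->
     first_wrong_weight R r l /\
     gT R r l =
       [set v | exists X : vfield R n.+2, exists D : vfield R n.+2 -> vfield R n.+2,
          [/\ gh r l%:Z X, second_kind r D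
            & from_vf r (fun Y => lie X Y + D Y) v]]) /\
  ((forall k : nat, tanaka R r k = vf_prolongation R r k) <->
   ell r < 0).
Proof.
have r0 := signature_gt0 hr; have rmax := signature_max hr.
have stage_ell l : l%:Z = ell r -> forall k, (k <= l)%N -> stage R r k.
  by move=> lE k kl; apply: (stage_le R hr) => m mk; rewrite -lE => -[]; lia.
split=> [l lE|].
  have St := stage_ell l lE; split; last exact: (gT_ell hr lE (St l (leqnn l))).
  split=> [k kl|].
    apply: (gT_eq_ghT hr); first by apply: St; exact: ltnW.
    by rewrite -lE => -[]; lia.
  split; first exact: (ghT_sub_gT r0 rmax (St l (leqnn l))).
  move=> H; have [v gv nv] := exists_not_vf hr lE (St l (leqnn l)).
  exact: (nv (H v gv)).
split=> [H|l0 k]; last first.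
  apply: msum_eq => m; apply: (gT_eq_ghT hr); last by lia.
  by apply: (stage_le R hr) => m' _; lia.
rewrite ltNge; apply/negP => l0.
have [l lE] : exists l : nat, l%:Z = ell r by exists `|ell r|%N; rewrite gez0_abs.
have St := stage_ell l lE.
have [v gv nv] := exists_not_vf hr lE (St l (leqnn l)).
(* Each lower layer contains at least the derivation [lie 0]; any such [u] serves to carry [v] into
   the prolongation. *)
have [k kl|u mu] := msum_nonempty (S := gT R r) (l := l) r0 rmax.
  have Sk := St k (ltnW kl).
  have [v' gv' _] := vder_gT r0 rmax Sk (vder_ad r0 (gh0 R r0 k%:Z)).
  by exists v'.
have : tanaka R r l (u, v) by split.
by rewrite H => -[_]; exact: nv.
Qed.
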